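(* Let $G$ be an abelian group, $\mathcal{D}$ a finite-dimensional simple real associative algebra, and $\Gamma_0$ a division $G$-grading on $\mathcal{D}$ for which it is not the case that $\mathcal{D}_e=Z(\mathcal{D})\cong\mathbb{C}$. Let $T$ be the support of $\Gamma_0$, $T^{[2]}=\{t^2\mid t\in T\}$, and let $K=\operatorname{supp}(C_{\mathcal{D}}(\mathcal{D}_e))$ be the support of the centralizer of the identity component. Then the stabilizer of $\Gamma_0$ is isomorphic to: (i) If $\Gamma_0$ is of type (1-a), (1-b) or (1-c): $\operatorname{Stab}(\Gamma_0)\cong\operatorname{Hom}(T,\{\pm1\})\cong T$. (ii) If $\Gamma_0$ is of type (1-d), then all automorphisms in $\operatorname{Stab}(\Gamma_0)$ are inner and $\operatorname{Stab}(\Gamma_0)\cong\operatorname{Hom}(T,\{\pm1\})\cong T/T^{[2]}$. (iii) If $\Gamma_0$ is of type (2-a), (2-b) or (2-c): $\operatorname{Stab}(\Gamma_0)\cong(\mathbb{C}^{\times}/\mathbb{R}^{\times})\rtimes T$, where the elements of $T\setminus K$ act on $\mathbb{C}^{\times}/\mathbb{R}^{\times}$ by (complex) conjugation and the elements of $K$ act trivially. (iv) If $\Gamma_0$ is of type (2-d) or (2-e), then all automorphisms in $\operatorname{Stab}(\Gamma_0)$ are inner and $\operatorname{Stab}(\Gamma_0)\cong(\mathbb{C}^{\times}/\mathbb{R}^{\times})\rtimes(T/T^{[2]})$, where the elements of $(T\setminus K)/T^{[2]}$ act on $\mathbb{C}^{\times}/\mathbb{R}^{\times}$ by (complex) conjugation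 and the elements of $K/T^{[2]}$ act trivially. (v) If $\Gamma_0$ is of type (3-a), (3-b) or (3-c): $\operatorname{Stab}(\Gamma_0)\cong\operatorname{Aut}(\mathbb{H})\times\operatorname{Hom}(T,\{\pm1\})\cong\operatorname{Aut}(\mathbb{H})\times T$. (vi) If $\Gamma_0$ is of type (3-d), then all automorphisms in $\operatorname{Stab}(\Gamma_0)$ are inner and $\operatorname{Stab}(\Gamma_0)\cong\operatorname{Aut}(\mathbb{H})\times\operatorname{Hom}(T,\{\pm1\})\cong\operatorname{Aut}(\mathbb{H})\times(T/T^{[2]})$.
   Context: A division $G$-grading on a unital algebra $\mathcal{D}$ is a grading $\mathcal{D}=\bigoplus_{g\in G}\mathcal{D}_g$ ($\mathcal{D}_g\mathcal{D}_h\subseteq\mathcal{D}_{gh}$) in which every nonzero homogeneous element is invertible; its support $T=\{g\mid\mathcal{D}_g\neq0\}$ is a subgroup of $G$. $e$ is the neutral element of $G$; $Z(\mathcal{D})$ is the center; $C_{\mathcal{D}}(\mathcal{D}_e)$ is the centralizer of $\mathcal{D}_e$ in $\mathcal{D}$, a graded subalgebra. $\operatorname{Stab}(\Gamma_0)$ is the group of $\mathbb{R}$-algebra automorphisms of $\mathcal{D}$ mapping every homogeneous component onto itself. $\operatorname{Aut}(\mathbb{H})$ is the group of $\mathbb{R}$-algebra automorphisms of the quaternions. All nonzero homogeneous components of $\Gamma_0$ have the same real dimension, which is $1$, $2$ or $4$ according as $\mathcal{D}_e\cong\mathbb{R},\mathbb{C},\mathbb{H}$, and $\mathcal{D}$ is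 isomorphic as a real algebra to $M_n(\mathbb{R})$, $M_{n/2}(\mathbb{H})$ or $M_n(\mathbb{C})$. If the dimension is $1$ or $4$, then $K=T$; if it is $2$ and $\mathcal{D}_e\neq Z(\mathcal{D})$, then $K$ is a subgroup of index $2$ in $T$. Types: the digit $1$, $2$, $3$ refers to homogeneous components of dimension $1$, $2$, $4$ respectively (for digit $2$ in the list below it is assumed that $\mathcal{D}_e\neq Z(\mathcal{D})$). Types (1-a), (2-a), (3-a): $\mathcal{D}\cong M_n(\mathbb{R})$. Types (1-b), (2-b), (3-b): $\mathcal{D}\cong M_{n/2}(\mathbb{H})$. Types (1-c), (2-c), (3-c): $\mathcal{D}\cong M_n(\mathbb{C})$ and $T$ is an elementary abelian $2$-group. Types (1-d) and (3-d): $\mathcal{D}\cong M_n(\mathbb{C})$ and $T$ is not an elementary abelian $2$-group. Types (2-d) and (2-e): $\mathcal{D}\cong M_n(\mathbb{C})$ and $T$ is not an elementary abelian $2$-group; it is (2-d) if $K$ is not an elementary abelian $2$-group and (2-e) if $K$ is. (In the non-elementary cases $T$ is isomorphic to a direct product of copies of $\mathbb{Z}_2$ and one copy of $\mathbb{Z}_4$.) *)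

(* Defs.v *)
From HB Require Import structures.
From mathcomp Require Import all_boot all_order all_algebra.
From mathcomp Require Import all_field.
From mathcomp Require Import boolp reals complex ring.

Set Implicit Arguments.
Unset Strict Implicit.
Unset Printing Implicit Defensive.

Import GRing.Theory.
Local Open Scope quotient_scope.
Local Open Scope ring_scope.

HB.mixin Record Group_isAbelian G of Group G := {
  mulgC : commutative (fun x y : G => (x * y)%g)
}.

#[short(type="abelGroupType")]
HB.structure Definition AbelGroup := {G of Group_isAbelian G & Group G}.

Definition group_iso (G H : groupType) : Prop :=
  exists f : {multiplicative G -> H}, bijective f.

Section AbelianQuotient.
Variables (A : abelGroupType) (N : groupClosed A).

Definition coset_rel (x y : A) : bool := (x / y)%g \in N.

Lemma coset_rel_equiv : equiv_class_of coset_rel.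
Proof.
split=> [x|x y|y x z]; rewrite /coset_rel.
- by rewrite mulgV gpred1.
- by rewrite -gpredV invgF.
- move=> xy yz; have -> : (x / z = (x / y) * (y / z))%g by rewrite mulgA mulgVK.
  exact: gpredM.
Qed.

Canonical coset_rel_equivRel := EquivRelPack coset_rel_equiv.

Definition quotg : Type := {eq_quot coset_rel}.

HB.instance Definition _ := Choice.on quotg.
HB.instance Definition _ := EqQuotient.on quotg.

Definition quotg_one : quotg := \pi_quotg 1%g.
Definition quotg_inv (x : quotg) : quotg := \pi_quotg ((repr x)^-1)%g.
Definition quotg_mul (x y : quotg) : quotg := \pi_quotg (repr x * repr y)%g.

Lemma pi_eqP (x y : A) : \pi_quotg x = \pi_quotg y <-> (x / y)%g \in N.
Proof. by split=> [/eqmodP|H]; [|apply/eqmodP]. Qed.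

Lemma repr_coset (x : A) : (repr (\pi_quotg x) / x)%g \in N.
Proof. by apply/pi_eqP; rewrite reprK. Qed.

Lemma quotg_mulE (x y : A) :
  quotg_mul (\pi_quotg x) (\pi_quotg y) = \pi_quotg (x * y)%g.
Proof.
apply/pi_eqP; rewrite invgM mulgA (mulgC (_ * _ / y)%g) !mulgA.
set a := repr _; set b := repr _.
have -> : (x^-1 * a * b / y = (a / x) * (b / y))%g.
  by rewrite (mulgC x^-1%g) !mulgA.
by apply: gpredM; exact: repr_coset.
Qed.

Lemma quotg_invE (x : A) : quotg_inv (\pi_quotg x) = \pi_quotg (x^-1)%g.
Proof.
by apply/pi_eqP; rewrite mulgC invgK -gpredV invgF repr_coset.
Qed.

Lemma quotg_mulA : associative quotg_mul.
Proof.
move=> x y z; rewrite -(reprK x) -(reprK y) -(reprK z).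
rewrite (quotg_mulE (repr y) (repr z)) (quotg_mulE (repr x) (repr y)).
by rewrite (quotg_mulE (repr x)) (quotg_mulE (_ * _)%g) mulgA.
Qed.

Lemma quotg_mulC : commutative quotg_mul.
Proof.
by move=> x y; rewrite -(reprK x) -(reprK y) 2!(quotg_mulE (repr _) (repr _)) mulgC.
Qed.

Lemma quotg_mul1g : left_id quotg_one quotg_mul.
Proof. by move=> x; rewrite -(reprK x) quotg_mulE mul1g. Qed.

Lemma quotg_mulg1 : right_id quotg_one quotg_mul.
Proof. by move=> x; rewrite quotg_mulC quotg_mul1g. Qed.

Lemma quotg_mulVg : left_inverse quotg_one quotg_inv quotg_mul.
Proof. by move=> x; rewrite -(reprK x) quotg_invE quotg_mulE mulVg. Qed.

Lemma quotg_mulgV : right_inverse quotg_one quotg_inv quotg_mul.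
Proof. by move=> x; rewrite quotg_mulC quotg_mulVg. Qed.

HB.instance Definition _ := isGroup.Build quotg
  quotg_mulA quotg_mul1g quotg_mulg1 quotg_mulVg quotg_mulgV.
HB.instance Definition _ := Group_isAbelian.Build quotg quotg_mulC.

Definition cosetg (x : A) : quotg := \pi_quotg x.

End AbelianQuotient.

Section Squares.
Variable A : abelGroupType.

Definition squares : {pred A} := fun x => `[< exists y : A, x = (y * y)%g >].

Lemma squares_closed : group_closed squares.
Proof.
split=> [|x y /asboolP[a ->] /asboolP[b ->]]; apply/asboolP.
  by exists 1%g; rewrite mulg1.
exists (a / b)%g; rewrite invgM -!mulgA; congr (_ * _)%g.
by rewrite [RHS]mulgC -!mulgA; congr (_ * _)%g; rewrite mulgC.
Qed.

(* isMulClosed has to come first for the instances below to be joined. *)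
HB.instance Definition _ :=
  isMulClosed.Build A squares (group_closedM squares_closed).
HB.instance Definition _ := isMul1Closed.Build A squares squares_closed.1.
HB.instance Definition _ :=
  isInvClosed.Build A squares (group_closedV squares_closed).

End Squares.

Arguments squares A : clear implicits.

Section UnitGroup.
Variable R : comUnitRingType.

Record units := Units { units_val :> R; _ : units_val \is a GRing.unit }.

HB.instance Definition _ := [isSub for units_val].
HB.instance Definition _ := [Choice of units by <:].

Definition units_one := Units (unitr1 R).
Definition units_inv (x : units) : units :=
  Units (introT idP (etrans (unitrV (val x)) (valP x))).
Definition units_mul (x y : units) : units :=
  Units (introT idP (etrans (unitrMl (val x) (valP y)) (valP x))).

Lemma units_mulA : associative units_mul.
Proof. by move=> x y z; apply/val_inj/mulrA. Qed.
Lemma units_mulC : commutative units_mul.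
Proof. by move=> x y; apply/val_inj/mulrC. Qed.
Lemma units_mul1g : left_id units_one units_mul.
Proof. by move=> x; apply/val_inj/mul1r. Qed.
Lemma units_mulg1 : right_id units_one units_mul.
Proof. by move=> x; apply/val_inj/mulr1. Qed.
Lemma units_mulVg : left_inverse units_one units_inv units_mul.
Proof. by move=> x; apply/val_inj/mulVr/valP. Qed.
Lemma units_mulgV : right_inverse units_one units_inv units_mul.
Proof. by move=> x; apply/val_inj/mulrV/valP. Qed.

HB.instance Definition _ := isGroup.Build units
  units_mulA units_mul1g units_mulg1 units_mulVg units_mulgV.
HB.instance Definition _ := Group_isAbelian.Build units units_mulC.

End UnitGroup.

(* {1, -1}, as the multiplicative group of units of the integers. *)
Definition pm1 : abelGroupType := units int.

Lemma pm1P (e : pm1) : val e = 1 \/ val e = -1.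
Proof. by have := valP e; rewrite unfold_in => /orP[] /eqP; [left|right]. Qed.

Section HomGroup.
Variables (A : groupType) (B : abelGroupType).

(* Hom(A, B), with pointwise multiplication. *)
Record homg := Homg {
  homg_fun :> A -> B;
  _ : `[< {morph homg_fun : x y / (x * y)%g} >] }.

HB.instance Definition _ := [isSub for homg_fun].
HB.instance Definition _ := [Choice of homg by <:].

Lemma homgM (f : homg) : {morph f : x y / (x * y)%g}.
Proof. exact/asboolP/(valP f). Qed.

Lemma homg_one_subproof : `[< {morph (fun _ : A => 1%g : B) : x y / (x * y)%g} >].
Proof. by apply/asboolP => x y; rewrite mulg1. Qed.
Lemma homg_inv_subproof (f : homg) :
  `[< {morph (fun x : A => (f x)^-1%g) : x y / (x * y)%g} >].
Proof. by apply/asboolP => x y; rewrite homgM invgM mulgC. Qed.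
Lemma homg_mul_subproof (f g : homg) :
  `[< {morph (fun x : A => (f x * g x)%g) : x y / (x * y)%g} >].
Proof.
apply/asboolP => x y; rewrite !homgM -!mulgA; congr (_ * _)%g.
by rewrite !mulgA (mulgC (f y)).
Qed.

Definition homg_one := Homg homg_one_subproof.
Definition homg_inv f := Homg (homg_inv_subproof f).
Definition homg_mul f g := Homg (homg_mul_subproof f g).

Lemma homg_mulA : associative homg_mul.
Proof. by move=> f g h; apply/val_inj/funext => x; apply: mulgA. Qed.
Lemma homg_mulC : commutative homg_mul.
Proof. by move=> f g; apply/val_inj/funext => x; apply: mulgC. Qed.
Lemma homg_mul1g : left_id homg_one homg_mul.
Proof. by move=> f; apply/val_inj/funext => x; apply: mul1g. Qed.
Lemma homg_mulg1 : right_id homg_one homg_mul.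
Proof. by move=> f; apply/val_inj/funext => x; apply: mulg1. Qed.
Lemma homg_mulVg : left_inverse homg_one homg_inv homg_mul.
Proof. by move=> f; apply/val_inj/funext => x; apply: mulVg. Qed.
Lemma homg_mulgV : right_inverse homg_one homg_inv homg_mul.
Proof. by move=> f; apply/val_inj/funext => x; apply: mulgV. Qed.

HB.instance Definition _ := isGroup.Build homg
  homg_mulA homg_mul1g homg_mulg1 homg_mulVg homg_mulgV.
HB.instance Definition _ := Group_isAbelian.Build homg homg_mulC.

End HomGroup.

Record gaction (H N : groupType) := Gaction {
  gact :> H -> N -> N;
  gact1 : forall x, gact 1%g x = x;
  gactM : forall h k x, gact (h * k)%g x = gact h (gact k x);
  gact_mul : forall h, {morph gact h : x y / (x * y)%g} }.

(* N ><| H on the set N * H, with (a, h)(b, k) = (a (h.b), hk); the action only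
   enters through the group law, so it is a phantom parameter of the carrier. *)
Definition sdprod (H N : groupType) (act : gaction H N) : Type :=
  (N * H)%type.

HB.instance Definition _ (H N : groupType) (act : gaction H N) :=
  Choice.on (sdprod act).

Section SemidirectProduct.
Variables (H N : groupType) (act : gaction H N).
Local Notation sdprod := (sdprod act).

Definition sdprod_one : sdprod := (1, 1)%g.
Definition sdprod_mul (x y : sdprod) : sdprod :=
  (x.1 * act x.2 y.1, x.2 * y.2)%g.
Definition sdprod_inv (x : sdprod) : sdprod :=
  (act x.2^-1%g x.1^-1%g, x.2^-1%g).

Lemma gact_1 h : act h 1%g = 1%g.
Proof. by apply: (mulgI (act h 1%g)); rewrite -gact_mul !mulg1. Qed.

Lemma sdprod_mulA : associative sdprod_mul.
Proof.
by move=> [a h] [b k] [c l]; rewrite /sdprod_mul /= gact_mul gactM !mulgA.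
Qed.
Lemma sdprod_mul1g : left_id sdprod_one sdprod_mul.
Proof. by move=> [a h]; rewrite /sdprod_mul /= gact1 !mul1g. Qed.
Lemma sdprod_mulg1 : right_id sdprod_one sdprod_mul.
Proof. by move=> [a h]; rewrite /sdprod_mul /= gact_1 !mulg1. Qed.
Lemma sdprod_mulVg : left_inverse sdprod_one sdprod_inv sdprod_mul.
Proof. by move=> [a h]; rewrite /sdprod_mul /= -gact_mul !mulVg gact_1. Qed.
Lemma sdprod_mulgV : right_inverse sdprod_one sdprod_inv sdprod_mul.
Proof. by move=> [a h]; rewrite /sdprod_mul /= -gactM !mulgV gact1 mulgV. Qed.

HB.instance Definition _ := isGroup.Build sdprod
  sdprod_mulA sdprod_mul1g sdprod_mulg1 sdprod_mulVg sdprod_mulgV.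

End SemidirectProduct.

Record quat (R : Type) := Quat { q_re : R; q_i : R; q_j : R; q_k : R }.

Section QuatChoice.
Variable R : Type.
Definition quat_tuple (x : quat R) : R * R * R * R :=
  let: Quat a b c d := x in (a, b, c, d).
Definition tuple_quat (x : R * R * R * R) : quat R :=
  let: (a, b, c, d) := x in Quat a b c d.
Lemma quat_tupleK : cancel quat_tuple tuple_quat.
Proof. by case. Qed.
End QuatChoice.

HB.instance Definition _ (R : choiceType) :=
  Choice.copy (quat R) (can_type (@quat_tupleK R)).

Section QuatAlgebra.
Variable R : fieldType.
Implicit Types x y z : quat R.

Definition quat_zero : quat R := Quat 0 0 0 0.
Definition quat_one : quat R := Quat 1 0 0 0.
Definition quat_opp x :=
  let: Quat a b c d := x in Quat (- a) (- b) (- c) (- d).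
Definition quat_add x y :=
  let: Quat a b c d := x in let: Quat a' b' c' d' := y in
  Quat (a + a') (b + b') (c + c') (d + d').
Definition quat_scale (t : R) x :=
  let: Quat a b c d := x in Quat (t * a) (t * b) (t * c) (t * d).
Definition quat_mul x y :=
  let: Quat a b c d := x in let: Quat a' b' c' d' := y in
  Quat (a * a' - b * b' - c * c' - d * d')
       (a * b' + b * a' + c * d' - d * c')
       (a * c' - b * d' + c * a' + d * b')
       (a * d' + b * c' - c * b' + d * a').


Lemma quat_addA : associative quat_add.
Proof. by case=> ? ? ? ? [? ? ? ?] [? ? ? ?]; rewrite /= !addrA. Qed.
Lemma quat_addC : commutative quat_add.
Proof. by case=> a b c d [e f g h]; congr Quat; apply: addrC. Qed.
Lemma quat_add0 : left_id quat_zero quat_add.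
Proof. by case=> *; rewrite /= !add0r. Qed.
Lemma quat_addN : left_inverse quat_zero quat_opp quat_add.
Proof. by case=> *; rewrite /= !addNr. Qed.

HB.instance Definition _ :=
  GRing.isZmodule.Build (quat R) quat_addA quat_addC quat_add0 quat_addN.

Lemma quat_mulA : associative quat_mul.
Proof. by case=> ? ? ? ? [? ? ? ?] [? ? ? ?]; congr Quat; ring. Qed.
Lemma quat_mul1 : left_id quat_one quat_mul.
Proof. by case=> *; congr Quat; ring. Qed.
Lemma quat_mulr1 : right_id quat_one quat_mul.
Proof. by case=> *; congr Quat; ring. Qed.
Lemma quat_mulDl : left_distributive quat_mul quat_add.
Proof. by case=> ? ? ? ? [? ? ? ?] [? ? ? ?]; congr Quat; ring. Qed.
Lemma quat_mulDr : right_distributive quat_mul quat_add.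
Proof. by case=> ? ? ? ? [? ? ? ?] [? ? ? ?]; congr Quat; ring. Qed.
Lemma quat_1neq0 : quat_one != 0 :> quat R.
Proof. by apply/eqP => -[] /eqP; rewrite oner_eq0. Qed.

HB.instance Definition _ := GRing.Zmodule_isNzRing.Build (quat R)
  quat_mulA quat_mul1 quat_mulr1 quat_mulDl quat_mulDr quat_1neq0.

Lemma quat_scaleA s t x :
  quat_scale s (quat_scale t x) = quat_scale (s * t) x.
Proof. by case: x => *; rewrite /= !mulrA. Qed.
Lemma quat_scale1 : left_id 1 quat_scale.
Proof. by case=> *; rewrite /= !mul1r. Qed.
Lemma quat_scaleDr : right_distributive quat_scale +%R.
Proof. by move=> s [? ? ? ?] [? ? ? ?]; congr Quat; apply: mulrDr. Qed.
Lemma quat_scaleDl x : {morph quat_scale^~ x : s t / s + t}.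
Proof. by case: x => ? ? ? ? s t; congr Quat; apply: mulrDl. Qed.

HB.instance Definition _ := GRing.Zmodule_isLmodule.Build R (quat R)
  quat_scaleA quat_scale1 quat_scaleDr quat_scaleDl.

Lemma quat_scaleAl (t : R) x y : t *: (x * y) = (t *: x) * y.
Proof. by case: x => ? ? ? ?; case: y => ? ? ? ?; congr Quat; ring. Qed.
HB.instance Definition _ :=
  GRing.Lmodule_isLalgebra.Build R (quat R) quat_scaleAl.

Lemma quat_scaleAr (t : R) x y : t *: (x * y) = x * (t *: y).
Proof. by case: x => ? ? ? ?; case: y => ? ? ? ?; congr Quat; ring. Qed.
HB.instance Definition _ :=
  GRing.Lalgebra_isAlgebra.Build R (quat R) quat_scaleAr.

Definition quat_row x : 'rV[R]_4 :=
  \row_i nth 0 [:: q_re x; q_i x; q_j x; q_k x] i.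
Definition row_quat (u : 'rV[R]_4) : quat R :=
  Quat (u 0 0) (u 0 1) (u 0 2%:R) (u 0 3%:R).

Lemma quat_vect_axiom : Vector.axiom 4 (quat R).
Proof.
exists quat_row.
  move=> t [? ? ? ?] [? ? ? ?]; apply/rowP => i; rewrite !mxE /=.
  by case: i => -[|[|[|[|]]]].
exists row_quat => [[? ? ? ?]|u].
  by rewrite /row_quat !mxE.
apply/rowP => i; rewrite !mxE; case: i => -[|[|[|[|]]]] //= lti;
  by congr (u _ _); apply/val_inj.
Qed.
HB.instance Definition _ := Lmodule_hasFinDim.Build R (quat R) quat_vect_axiom.
HB.instance Definition _ := Algebra_isFalgebra.Build R (quat R).

End QuatAlgebra.

Section AlgebraAutomorphisms.
Variables (F : fieldType) (A : falgType F).

Record algAut := AlgAut {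
  algAut_end :> 'AEnd(A);
  _ : lker algAut_end == 0%VS }.

HB.instance Definition _ := [isSub for algAut_end].
HB.instance Definition _ := [Choice of algAut by <:].

Implicit Types f g h : algAut.

Lemma algAut_ker f : lker f == 0%VS. Proof. exact: valP f. Qed.

Lemma algAut_inv_ahom f : ahom_in {:A} (f^-1)%VF.
Proof.
have K := lker0_lfunK (algAut_ker f); have VK := lker0_lfunVK (algAut_ker f).
apply/ahom_inP; split=> [x y _ _|]; apply: (can_inj K).
  by rewrite rmorphM /= !VK.
by rewrite VK rmorph1.
Qed.

Lemma algAut_one_ker : lker (\1%AF : 'AEnd(A)) == 0%VS.
Proof. by apply/lker0P => x y; rewrite !id_lfunE. Qed.
Lemma algAut_inv_ker f : lker (AHom (algAut_inv_ahom f)) == 0%VS.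
Proof. by apply/lker0P/(can_inj (lker0_lfunVK (algAut_ker f))). Qed.
Lemma algAut_mul_ker f g : lker (f \o g)%AF == 0%VS.
Proof.
apply/lker0P => x y; rewrite !comp_lfunE.
by move=> /(lker0P (algAut_ker f)) /(lker0P (algAut_ker g)).
Qed.

Definition algAut_one := AlgAut algAut_one_ker.
Definition algAut_inv f := AlgAut (algAut_inv_ker f).
Definition algAut_mul f g := AlgAut (algAut_mul_ker f g).

Lemma algAutP f g : (forall x, f x = g x) -> f = g.
Proof. by move=> fg; do 2!apply/val_inj; apply/lfunP. Qed.

Lemma algAut_mulA : associative algAut_mul.
Proof. by move=> f g h; apply: algAutP => x; rewrite !comp_lfunE. Qed.
Lemma algAut_mul1g : left_id algAut_one algAut_mul.
Proof. by move=> f; apply: algAutP => x; rewrite comp_lfunE id_lfunE. Qed.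
Lemma algAut_mulg1 : right_id algAut_one algAut_mul.
Proof. by move=> f; apply: algAutP => x; rewrite comp_lfunE id_lfunE. Qed.
Lemma algAut_mulVg : left_inverse algAut_one algAut_inv algAut_mul.
Proof.
move=> f; apply: algAutP => x; rewrite comp_lfunE id_lfunE.
exact: lker0_lfunK (algAut_ker f) x.
Qed.
Lemma algAut_mulgV : right_inverse algAut_one algAut_inv algAut_mul.
Proof.
move=> f; apply: algAutP => x; rewrite comp_lfunE id_lfunE.
exact: lker0_lfunVK (algAut_ker f) x.
Qed.

HB.instance Definition _ := isGroup.Build algAut
  algAut_mulA algAut_mul1g algAut_mulg1 algAut_mulVg algAut_mulgV.

Definition inner_aut f : Prop :=
  exists2 u : A, u \is a GRing.unit & forall x, f x = u * x * u^-1.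

Definition simple_algebra : Prop :=
  forall I : {vspace A}, ({:A} * I <= I)%VS -> (I * {:A} <= I)%VS ->
    I = 0%VS \/ I = {:A}%VS.

End AlgebraAutomorphisms.

(* V is a unital subalgebra of A isomorphic to B as an F-algebra. *)
Definition subalgebra_iso (F : fieldType) (B : lalgType F) (A : falgType F)
    (V : {vspace A}) : Prop :=
  exists f : {lrmorphism B -> A},
    injective f /\ (forall x : A, x \in V <-> exists b, f b = x).

(* A is isomorphic to M_n(B), n >= 1, as an F-algebra; the library's scaling on
   'M[B]_n is by elements of B, so F acts through t |-> t%:A. *)
Definition matrix_algebra_iso (F : fieldType) (B : lalgType F)
    (A : falgType F) : Prop :=
  exists n (f : {rmorphism A -> 'M[B]_n.+1}),
    bijective f /\ (forall (t : F) (x : A), f (t *: x) = t%:A *: f x).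

(* As A is finite-dimensional, it is the sum of finitely many components. *)
Record divGrading (G : groupType) (F : fieldType) (A : falgType F) :=
  DivGrading {
    hcomp :> G -> {vspace A};
    hcomp_direct : forall s : seq G, uniq s -> directv (\sum_(g <- s) hcomp g);
    hcomp_span : exists s : seq G, (\sum_(g <- s) hcomp g = {:A})%VS;
    hcompM : forall g h, (hcomp g * hcomp h <= hcomp (g * h)%g)%VS;
    hcomp_unit : forall g x, x \in hcomp g -> x != 0 -> x \is a GRing.unit }.

Section Support.
Variables (G : abelGroupType) (F : fieldType) (A : falgType F).
Variable Gm : divGrading G A.

Definition supp : {pred G} := [pred g | Gm g != 0%VS].

Lemma supp_mul : {in supp &, forall g h, (g * h)%g \in supp}.
Proof.
move=> g h; rewrite !inE => g0 h0; apply/eqP => gh0.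
have Ug : vpick (Gm g) \is a GRing.unit.
  by apply: hcomp_unit (memv_pick _) _; rewrite vpick0.
have Uh : vpick (Gm h) \is a GRing.unit.
  by apply: hcomp_unit (memv_pick _) _; rewrite vpick0.
have /eqP : vpick (Gm g) * vpick (Gm h) == 0.
  rewrite -memv0 -gh0; apply: (subvP (hcompM Gm g h)).
  by rewrite memv_mul ?memv_pick.
by move=> gh; have := unitr0 A; rewrite -gh unitrMl ?Ug.
Qed.

Lemma supp_finite : exists s : seq G, {subset supp <= s}.
Proof.
have [s sE] := hcomp_span Gm; exists s => g; rewrite inE => g0.
case: (boolP (g \in s)) => // gs; case/negP: g0.
have full : (\sum_(h <- undup s) Gm h = {:A})%VS.
  apply/eqP; rewrite eqEsubv subvf /= -[X in (X <= _)%VS]sE.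
  have : {subset s <= undup s} by move=> h; rewrite mem_undup.
  move: (undup s) => u; elim: (s) => [|h t IH] ht; first by rewrite big_nil sub0v.
  rewrite big_cons subv_add IH => [|k kt]; last by rewrite ht ?inE ?kt ?orbT.
  by rewrite andbT (big_rem h) ?addvSl //= ht ?mem_head.
have ug : uniq (g :: undup s) by rewrite /= mem_undup gs undup_uniq.
have := hcomp_direct Gm ug; have := hcomp_direct Gm (undup_uniq s).
rewrite !directvE /= !big_cons full => /eqP <-.
rewrite addvf => /eqP/esym/eqP; rewrite -[X in _ == X]add0n eqn_add2r.
by rewrite dimv_eq0.
Qed.

Lemma supp_nonempty : exists g, g \in supp.
Proof.
have [s sE] := hcomp_span Gm; case: (pselect (exists g, g \in supp)) => // no.
have : (1 : A) \in {:A}%VS by rewrite memvf.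
rewrite -sE big1 ?memv0 ?oner_eq0 // => g _; apply/eqP/negPn/negP => g0.
by apply: no; exists g; rewrite inE.
Qed.

Lemma supp_closed : group_closed supp.
Proof.
have suppX g n : g \in supp -> (g ^+ n.+1)%g \in supp.
  move=> gs; elim: n => [|n IH]; first by rewrite expg1.
  by rewrite expgS supp_mul.
have [s sP] := supp_finite.
have order g : g \in supp -> exists n, (g ^+ n.+1 = 1)%g.
  move=> gs; pose f (i : 'I_(size s).+1) := (g ^+ i.+1)%g.
  have /injectivePn[i [j ij fij]] : ~~ injectiveb f.
    apply/negP => /injectiveP finj.
    have /uniq_leq_size : uniq (codom f) by rewrite map_inj_uniq ?enum_uniq.
    move=> /(_ s); rewrite size_codom card_ord ltnn => H; suff: false by [].
    by apply: H => _ /codomP[i ->]; apply/sP/suppX.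
  wlog lt_ij : i j ij fij / (i < j)%N.
    move=> W; case: (ltngtP i j) => [||/val_inj ijE]; first exact: W.
    - by apply: W => //; rewrite eq_sym.
    - by rewrite ijE eqxx in ij.
  exists (j - i).-1; rewrite prednK ?subn_gt0 //; apply: (mulgI (f i)).
  by rewrite mulg1 -expgnDr fij addSn subnKC // ltnW.
have [g0 g0s] := supp_nonempty.
have s1 : 1%g \in supp by have [n <-] := order _ g0s; apply: suppX.
split=> // x y xs ys; apply: supp_mul => //; have [n yn] := order _ ys.
have -> : (y^-1 = y ^+ n)%g by apply: (mulgI y); rewrite mulgV -expgS.
by case: n {yn} => [|n]; [rewrite expg0|apply: suppX].
Qed.

Record suppg := Suppg { suppg_val :> G; _ : suppg_val \in supp }.

HB.instance Definition _ := [isSub for suppg_val].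
HB.instance Definition _ := [Choice of suppg by <:].
HB.instance Definition _ := SubChoice_isSubGroup.Build G supp suppg supp_closed.

Lemma suppg_mulC : commutative (fun x y : suppg => (x * y)%g).
Proof. by move=> x y; apply/val_inj; exact: (mulgC (val x) (val y)). Qed.
HB.instance Definition _ := Group_isAbelian.Build suppg suppg_mulC.

(* Support of the (graded) centralizer of the identity component. *)
Definition cent_supp : {pred G} :=
  [pred g | ('C(Gm 1%g) :&: Gm g)%VS != 0%VS].

Definition stab : {pred algAut A} :=
  fun f => `[< forall g, (f @: Gm g = Gm g)%VS >].

Lemma stab_closed : group_closed stab.
Proof.
split=> [|f h /asboolP fS /asboolP hS]; apply/asboolP => g.
  by rewrite lim1g.
rewrite -[in LHS](hS g) -limg_comp -[RHS](fS g); congr (_ @: _)%VS.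
apply/lfunP => x; rewrite !comp_lfunE /=.
by rewrite (lker0_lfunK (algAut_ker h)).
Qed.

Record stabg := Stabg { stabg_val :> algAut A; _ : stabg_val \in stab }.

HB.instance Definition _ := [isSub for stabg_val].
HB.instance Definition _ := [Choice of stabg by <:].
HB.instance Definition _ :=
  SubChoice_isSubGroup.Build (algAut A) stab stabg stab_closed.

End Support.

Section ComplexModReal.
Variable R : realType.

Definition real_units : {pred units R[i]} :=
  [pred z | complex.Im (val z) == 0].

Lemma real_units_closed : group_closed real_units.
Proof.
split=> [|[[a b] u] [[c d] v]]; rewrite !inE /= ?eqxx // => /eqP-> /eqP->.
by rewrite /= !(mul0r, mulr0, oppr0, addr0) eqxx.
Qed.

HB.instance Definition _ :=
  isMulClosed.Build (units R[i]) real_units (group_closedM real_units_closed).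
HB.instance Definition _ :=
  isMul1Closed.Build (units R[i]) real_units real_units_closed.1.
HB.instance Definition _ :=
  isInvClosed.Build (units R[i]) real_units (group_closedV real_units_closed).

Definition CxRx : abelGroupType := quotg real_units.

Lemma conj_units_subproof (z : units R[i]) :
  conjc (val z) \is a GRing.unit.
Proof. by rewrite rmorph_unit ?(valP z). Qed.

Definition conj_units (z : units R[i]) : units R[i] :=
  Units (conj_units_subproof z).

Definition CxRx_class (z : units R[i]) : CxRx := cosetg real_units z.

End ComplexModReal.

Section Types.
Variables (R : realType) (G : abelGroupType) (D : falgType R).
Variable Gm : divGrading G D.

Definition components_dim (d : nat) : Prop :=
  {in supp Gm, forall t, \dim (Gm t) = d}.

Definition elementary2 (S : {pred G}) : Prop :=
  {in S, forall t, (t * t = 1)%g}.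

Definition is_MnR : Prop := matrix_algebra_iso R^o D.
Definition is_MnH : Prop := matrix_algebra_iso (quat R) D.
Definition is_MnC : Prop := matrix_algebra_iso (Rcomplex R) D.

(* The first digit of a type. Digit 2 leaves out the gradings whose identity
   component is the whole (complex) center. *)
Definition digit1 : Prop := components_dim 1.
Definition digit2 : Prop := components_dim 2 /\ Gm 1%g <> 'Z({:D})%VS.
Definition digit3 : Prop := components_dim 4.

Definition type_1a := digit1 /\ is_MnR.
Definition type_1b := digit1 /\ is_MnH.
Definition type_1c := [/\ digit1, is_MnC & elementary2 (supp Gm)].
Definition type_1d := [/\ digit1, is_MnC & ~ elementary2 (supp Gm)].

Definition type_2a := digit2 /\ is_MnR.
Definition type_2b := digit2 /\ is_MnH.
Definition type_2c := [/\ digit2, is_MnC & elementary2 (supp Gm)].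
Definition type_2d := [/\ digit2, is_MnC, ~ elementary2 (supp Gm)
                        & ~ elementary2 (cent_supp Gm)].
Definition type_2e := [/\ digit2, is_MnC, ~ elementary2 (supp Gm)
                        & elementary2 (cent_supp Gm)].

Definition type_3a := digit3 /\ is_MnR.
Definition type_3b := digit3 /\ is_MnH.
Definition type_3c := [/\ digit3, is_MnC & elementary2 (supp Gm)].
Definition type_3d := [/\ digit3, is_MnC & ~ elementary2 (supp Gm)].

End Types.

(* Main.v *)
From HB Require Import structures.
Require Import Defs.
From mathcomp Require Import all_boot all_order all_algebra all_field.
From mathcomp Require Import boolp reals complex ring lra.

(* Choose nonzero y_t in D_t spanning a twisted group ring of T over R: any y_t if the
   components are lines, y_t commuting with D_e if D_e is the quaternions, y_t commuting
   with a fixed x_0 in D_t0, t0 outside K, if D_e is the complex numbers. An automorphism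
   f in the stabilizer acts on the y_t (in the complex case: only for t in K, and t0 takes
   the sign by which f acts on the imaginary unit) by a character with values in {1, -1},
   since a real character of a finite group has such values; this gives a
   homomorphism Psi from the stabilizer onto Hom(T, {1, -1}). The rest of f is its
   action on D_e: nothing, a quaternion automorphism (inner, by averaging over
   the quaternion group), or the phase z / conj z with f x_0 = (z / conj z) x_0.

   The composite t |-> Psi (Int y_t) is a homomorphism from T to Hom(T, {1, -1}) whose
   kernel consists of t with y_t central. It kills squares, so T is elementary if the
   center is R; if the center has dimension 2 and T is not elementary, the kernel is
   exactly T^[2], and by counting every character is Psi (Int y_t) for some t, so that
   all automorphisms are inner. For the semidirect products, a basis of T / T^[2]
   consisting of t0 and elements of K / T^[2] yields an isomorphism of T / T^[2] with
   Hom(T, {1, -1}) that turns evaluation at t0 into the character with kernel K. *)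

Set Implicit Arguments.
Unset Strict Implicit.
Unset Printing Implicit Defensive.

Import Order.TTheory GRing.Theory Num.Theory.
Local Open Scope ring_scope.

(** * Finite elementary abelian 2-groups *)

Lemma group_isoP (G H : groupType) (f : G -> H) :
  {morph f : x y / (x * y)%g} -> injective f -> (forall y, exists x, f x = y) ->
  group_iso G H.
Proof.
move=> fM fI /choice[g gK].
have fF : {morph f : x y / (x / y)%g}.
  by move=> x y; rewrite -[in f x](mulgVK y x) [in RHS]fM mulgK.
pose fm : {multiplicative G -> H} := HB.pack f (isGroupMorphism.Build G H f fF).
by exists fm; exists g => // x; apply: fI; rewrite gK.
Qed.

Lemma group_iso_sym (G H : groupType) : group_iso G H -> group_iso H G.
Proof.
move=> [f [g fK gK]]; apply: (@group_isoP _ _ g).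
- exact: can2_gmulfM fK gK.
- exact: can_inj gK.
- by move=> x; exists (f x).
Qed.

Lemma group_iso_prod (G H K : groupType) :
  group_iso H K -> group_iso (G * H)%type (G * K)%type.
Proof.
move=> [f [g fK gK]].
apply: (@group_isoP _ _ (fun x : G * H => (x.1, f x.2) : (G * K)%type)).
- by move=> [a b] [c d]; congr pair => /=; rewrite gmulfM.
- by move=> [a b] [c d] [-> /(can_inj fK) ->].
- by move=> [a b]; exists (a, g b); rewrite /= gK.
Qed.

Lemma morph_mul1 (G H : groupType) (f : G -> H) :
  {morph f : x y / (x * y)%g} -> f 1%g = 1%g.
Proof. by move=> fM; apply: (mulgI (f 1%g)); rewrite -fM !mulg1. Qed.

Lemma morph_inj (G H : groupType) (f : G -> H) :
  {morph f : x y / (x * y)%g} -> (forall x, f x = 1%g -> x = 1%g) -> injective f.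
Proof.
move=> fM fK x y fxy; apply: divg1_eq; apply: fK; apply: (mulIg (f y)).
by rewrite -fM mulgVK mul1g.
Qed.

Lemma finite_order (A : groupType) (l : seq A) (a : A) :
  (forall x, x \in l) -> exists n, (a ^+ n.+1 = 1)%g.
Proof.
move=> lP; pose f (i : 'I_(size l).+1) := (a ^+ i)%g.
have /injectivePn[i [j ij fij]] : ~~ injectiveb f.
  apply/negP => /injectiveP finj.
  have /uniq_leq_size : uniq (codom f) by rewrite map_inj_uniq ?enum_uniq.
  by move=> /(_ l (fun x _ => lP x)); rewrite size_codom card_ord ltnn.
wlog lt_ij : i j ij fij / (i < j)%N.
  move=> W; case: (ltngtP i j) => [||/val_inj ijE]; first exact: W.
  - by apply: W => //; rewrite eq_sym.
  - by rewrite ijE eqxx in ij.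
exists (j - i).-1; rewrite prednK ?subn_gt0 //; apply: (mulgI (f i)).
by rewrite mulg1 -expgnDr subnKC // ltnW.
Qed.

(** Pigeonhole principle for types whose finiteness is known through an exhausting list. *)
Lemma uniq_inj_onto (A B : eqType) (la : seq A) (lb : seq B) (f : A -> B) :
  uniq la -> (forall b, b \in lb) -> injective f -> (size lb <= size la)%N ->
  forall b, exists a, f a = b.
Proof.
move=> ua lbP fI szl b; have um : uniq (map f la) by rewrite map_inj_uniq.
have [|_ /(_ b)] := uniq_min_size um (fun x _ => lbP x); first by rewrite size_map.
by rewrite lbP => /mapP[a _ ->]; exists a.
Qed.

Lemma pm1_sq (e : pm1) : (e * e = 1)%g.
Proof. by apply/val_inj; case: (pm1P e) => /= ->. Qed.

Definition pmb (b : bool) : pm1 := if b then Units (unitrN1 int) else 1%g.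
Definition sgb (e : pm1) : bool := val e == -1.

Lemma unitsM (A : comUnitRingType) (x y : units A) : val (x * y)%g = val x * val y.
Proof. by []. Qed.

Lemma pmbM : {morph pmb : a b / a (+) b >-> (a * b)%g}.
Proof. by case=> -[]; apply/val_inj; rewrite unitsM. Qed.
Lemma sgbK : cancel sgb pmb.
Proof. by move=> e; apply/val_inj; rewrite /sgb; case: (pm1P e) => ->. Qed.
Lemma pmbK : cancel pmb sgb.
Proof. by case. Qed.

Lemma pm1_neq1 (e : pm1) : e <> 1%g -> e = pmb true.
Proof. by case: (pm1P e) => eE; [case; apply/val_inj|move=> _; apply/val_inj]. Qed.

(** * Bases and duality over the field with two elements *)

Section ElementaryBasis.
Variable W : abelGroupType.
Hypothesis W2 : forall w : W, (w * w = 1)%g.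

(** Linear combinations over the field with two elements. The coefficients are a function on all of
    [nat], of which only the values below [size s] matter. *)
Fixpoint ev (s : seq W) (c : nat -> bool) : W :=
  if s is b :: s' then ((if c 0%N then b else 1) * ev s' (fun i => c i.+1))%g
  else 1%g.

Lemma eq_ev s c d : (forall i, (i < size s)%N -> c i = d i) -> ev s c = ev s d.
Proof.
elim: s c d => //= b s IH c d cd; rewrite (cd 0%N) // (IH _ (fun i => d i.+1)) //.
by move=> i si; apply: cd.
Qed.

Lemma mulgACA (x y z t : W) : (x * y * (z * t) = x * z * (y * t))%g.
Proof. by rewrite -!mulgA; congr (_ * _)%g; rewrite !mulgA (mulgC y). Qed.

Lemma evM s c d : ev s (fun i => c i (+) d i) = (ev s c * ev s d)%g.
Proof.
elim: s c d => [|b s IH] c d /=; first by rewrite mulg1.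
rewrite IH mulgACA; congr (_ * _)%g.
by case: (c _); case: (d _); rewrite ?mulg1 ?mul1g.
Qed.

Lemma ev0 s : ev s (fun=> false) = 1%g.
Proof. by elim: s => //= b s ->; rewrite mulg1. Qed.

Lemma ev_delta s x0 j : (j < size s)%N -> ev s (eq_op j) = nth x0 s j.
Proof.
elim: s j => //= b s IH [|j] js.
  by rewrite (@eq_ev _ _ (fun=> false)) // ev0 mulg1.
by rewrite /= mul1g -IH //; apply: eq_ev => i _; rewrite eqSS.
Qed.

Definition indep s := forall c, ev s c = 1%g -> forall i, (i < size s)%N -> c i = false.
Definition spanned s w := exists c, ev s c = w.

Lemma spannedM s v w : spanned s v -> spanned s w -> spanned s (v * w)%g.
Proof. by move=> [c <-] [d <-]; exists (fun i => c i (+) d i); rewrite evM. Qed.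

Lemma spanned_cons s b w : spanned s w -> spanned (b :: s) w.
Proof.
by move=> [c <-]; exists (fun i => if i is j.+1 then c j else false); rewrite /= mul1g.
Qed.

(** A relation involving [b] could be solved for [b], which is its own inverse. *)
Lemma indep_cons s b : indep s -> ~ spanned s b -> indep (b :: s).
Proof.
move=> si sb c /=; case c0 : (c 0%N) => cE.
  case: sb; exists (fun i => c i.+1).
  by apply: (mulgI b); rewrite cE W2.
by rewrite mul1g in cE; case=> // i /=; apply: si cE _.
Qed.

(** An element of [l] joins the basis only when it is not yet spanned. The last clause records where
    basis vectors come from: [elementary_dual] wants them to be [t0] or in the kernel of [kappa]. *)
Lemma indep_extend s0 l : indep s0 -> exists s, [/\ indep s,
  forall w, spanned s0 w -> spanned s w, {in l, forall w, spanned s w} &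
  {subset s <= l ++ s0}].
Proof.
move=> s0i; elim: l => [|g l [s [si s0s ls sub]]].
  by exists s0; split.
case: (pselect (spanned s g)) => [gs|ngs].
  exists s; split=> // [w|w ws]; first by rewrite inE => /orP[/eqP->//|/ls].
  by rewrite inE sub ?orbT.
exists (g :: s); split=> [|w sw|w|w].
- exact: indep_cons.
- exact/spanned_cons/s0s.
- rewrite inE => /orP[/eqP->|/ls]; last exact: spanned_cons.
  by exists (eq_op 0%N); rewrite (@ev_delta (g :: s) g 0).
- by rewrite !inE => /orP[->//|/sub ->]; rewrite orbT.
Qed.

Lemma eq_char_spanned (f g : W -> pm1) s w :
  {morph f : x y / (x * y)%g} -> {morph g : x y / (x * y)%g} ->
  {in s, f =1 g} -> spanned s w -> f w = g w.
Proof.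
move=> fM gM fg [c <-]; elim: s c fg => /= [|b s IH] c fg; first by rewrite !morph_mul1.
rewrite fM gM IH => [|x xs]; last by rewrite fg // inE xs orbT.
by congr (_ * _)%g; case: (c _); [rewrite fg ?mem_head|rewrite !morph_mul1].
Qed.

(* For [kappa = 1] this is the duality of a finite elementary abelian 2-group with
   itself; otherwise the isomorphism is adapted to the hyperplane [kappa = 1]. *)
Lemma elementary_dual (l : seq W) (kappa : W -> pm1) (t0 : W) :
    (forall w, w \in l) -> {morph kappa : x y / (x * y)%g} ->
  exists th : W -> W -> pm1,
  [/\ forall w, {morph th w : x y / (x * y)%g},
      forall v, {morph th^~ v : x y / (x * y)%g},
      forall w, (forall v, th w v = 1%g) -> w = 1%g,
      forall f, {morph f : x y / (x * y)%g} -> exists w, forall v, th w v = f v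
    & kappa t0 <> 1%g -> forall w, th w t0 = kappa w].
Proof.
move=> lP kM.
(* If [kappa t0] is -1, the basis starts with [t0] and is completed inside the kernel of [kappa];
   otherwise any basis will do. *)
pose ad := kappa t0 != 1%g.
pose s0 := if ad then [:: t0] else [::].
pose l' := if ad then [seq w <- l | kappa w == 1%g] else l.
have s0i : indep s0.
  rewrite /s0; case: ifP => // adt c; rewrite /= mulg1.
  case c0 : (c 0%N); last by move=> _ [].
  move=> t1.  by move: adt; rewrite /ad t1 morph_mul1 // eqxx.
have [s [si s0s l's sub]] := indep_extend l' s0i.
have all_sp w : spanned s w.
  move: l's s0s; rewrite /l' /s0; case: ifP => adt; last by move=> + _; apply.
  move=> l's s0s.
  have ts : spanned s t0.
    by apply: s0s; exists (fun=> true); rewrite /= mulg1.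
  case: (eqVneq (kappa w) 1%g) => kw; first by apply: l's; rewrite mem_filter kw eqxx lP.
  (* If [w] is outside the kernel of [kappa], then [w * t0] is inside. *)
  have -> : w = (w * t0 * t0)%g by rewrite -mulgA W2 mulg1.
  apply: spannedM ts; apply: l's; rewrite mem_filter lP andbT kM.
  by rewrite (pm1_neq1 (elimN eqP kw)) (pm1_neq1 (elimN eqP adt)) pm1_sq.
have [co coK] := choice all_sp.
have coU w c : ev s c = w -> forall i, (i < size s)%N -> co w i = c i.
  move=> cw i i_s.
  have := si (fun i => co w i (+) c i); rewrite evM coK cw W2 => /(_ erefl i i_s).
  by case: (co w i); case: (c i).
have coM v w i : (i < size s)%N -> co (v * w)%g i = co v i (+) co w i.
  by apply: (coU _ (fun i => co v i (+) co w i)); rewrite evM !coK.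
(* The standard bilinear form in the coordinates given by [s]. *)
pose dot (c d : nat -> bool) := \big[addb/false]_(i < size s) (c i && d i).
pose th w v := pmb (dot (co w) (co v)).
have dot_delta c d j : (j < size s)%N ->
    (forall i, (i < size s)%N -> d i = (j == i)) -> dot c d = c j.
  move=> js dj; rewrite /dot (bigD1 (Ordinal js)) //= dj // eqxx andbT big1 ?addbF //.
  move=> i ij; rewrite dj //; case: eqP => [jE|]; last by rewrite andbF.
  by case/eqP: ij; apply/val_inj.
have thMr w : {morph th w : x y / (x * y)%g}.
  move=> x y; rewrite /th -pmbM /dot -big_split; congr pmb.
  by apply: eq_bigr => i _ /=; rewrite coM // andb_addr.
have thMl v : {morph th^~ v : x y / (x * y)%g}.
  move=> x y; rewrite /th -pmbM /dot -big_split; congr pmb.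
  by apply: eq_bigr => i _ /=; rewrite coM // andb_addl.
have co_nth j : (j < size s)%N -> forall i, (i < size s)%N -> co (nth 1%g s j) i = (j == i).
  by move=> js; apply: (coU _ (eq_op j)); exact: ev_delta.
have th_nth w j : (j < size s)%N -> th w (nth 1%g s j) = pmb (co w j).
  by move=> js; rewrite /th (dot_delta _ _ j) //; exact: co_nth.
exists th; split=> //.
- move=> w w1; rewrite -(coK w) -(ev0 s); apply: eq_ev => j js.
  by apply: (can_inj pmbK); rewrite -th_nth // w1.
- move=> f fM; pose c i := sgb (f (nth 1%g s i)); exists (ev s c) => v.
  apply: (@eq_char_spanned _ _ s) => // b bs.
  rewrite -(nth_index 1%g bs); have js : (index b s < size s)%N by rewrite index_mem.
  by rewrite th_nth // (coU _ c) // sgbK.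
(* Here [t0] is a basis vector, since otherwise [kappa] would be trivial on [s]. Both [th^~ t0] and
   [kappa] are -1 at [t0] and 1 at the other basis vectors. *)
- move=> kt w; have adt : ad by apply/eqP.
  move: s0s sub; rewrite /s0 /l' adt => s0s sub.
  have ts : t0 \in s.
    apply/negPn/negP => nts.
    have st0 : spanned s t0 by apply: s0s; exists (fun=> true); rewrite /= mulg1.
    case: kt; apply: (@eq_char_spanned kappa (fun=> 1%g) s) st0 => //.
      by move=> x y; rewrite mulg1.
    move=> b bs; have := sub b bs; rewrite mem_cat mem_filter inE.
    by case/orP=> [/andP[/eqP->]//|/eqP bE]; rewrite -bE bs in nts.
  apply: (@eq_char_spanned (th^~ t0) kappa s) => // b bs.
  rewrite -{1}(nth_index 1%g ts) th_nth ?index_mem //.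
  rewrite -{1}(nth_index 1%g bs) co_nth ?index_mem //.
  have := sub b bs; rewrite mem_cat mem_filter inE orbC.
  case: eqVneq => [->|bt] /=; first by rewrite eqxx (pm1_neq1 kt).
  case/andP=> /eqP kb _; rewrite kb.
  case: eqP => // ii; case/eqP: bt.
  by rewrite -(nth_index 1%g bs) ii nth_index.
Qed.

End ElementaryBasis.

(** * Sign characters of a finite abelian group and its quotient by squares *)

Section DualOfQuotient.
Variables (T W : abelGroupType) (l : seq T) (p : T -> W).
Hypotheses (lP : forall t, t \in l) (pM : {morph p : x y / (x * y)%g}).
Hypotheses (p_onto : forall w, exists t, p t = w).
Hypothesis p_ker : forall t, p t = 1%g <-> exists s, t = (s * s)%g.

Lemma homg_eq (f g : homg T pm1) : (forall t, f t = g t) -> f = g.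
Proof. by move=> fg; apply/val_inj/funext. Qed.

Lemma homgME (f g : homg T pm1) t : (f * g)%g t = (f t * g t)%g.
Proof. by []. Qed.

(** Signs have square 1, so [f] kills squares, that is, the kernel of [p]. *)
Lemma homg_factor (f : homg T pm1) : exists2 g : W -> pm1,
  {morph g : x y / (x * y)%g} & forall t, g (p t) = f t.
Proof.
have [r rK] := choice p_onto.
have rP t : f (r (p t)) = f t.
  have /p_ker[s sE] : p (r (p t) / t)%g = 1%g.
    by apply: (mulIg (p t)); rewrite -pM mulgVK rK mul1g.
  by rewrite -[r _](mulgVK t) homgM sE homgM pm1_sq mul1g.
exists (fun w => f (r w)) => // x y.
by rewrite -homgM -(rP (r x * r y)%g) pM !rK.
Qed.

(** Squares die in [W], so [elementary_dual] applies to [W]; by [homg_factor] the characters of [T]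
    are those of [W]. *)
Lemma quotient_dual (kappa : homg T pm1) (t0 : T) : exists th : W -> homg T pm1,
  [/\ {morph th : x y / (x * y)%g}, injective th, forall f, exists w, th w = f
    & kappa t0 <> 1%g -> forall t, th (p t) t0 = kappa t].
Proof.
have W2 (w : W) : (w * w = 1)%g.
  by have [t <-] := p_onto w; rewrite -pM; apply/p_ker; exists t.
have lW (w : W) : w \in map p l by have [t <-] := p_onto w; apply/map_f.
have [k kM kE] := homg_factor kappa.
have [th [thMr thMl th0 thS thk]] := elementary_dual W2 (p t0) lW kM.
have thH w : `[< {morph (fun t => th w (p t)) : x y / (x * y)%g} >].
  by apply/asboolP => x y; rewrite pM thMr.
exists (fun w => Homg (thH w)); split.
- by move=> x y; apply: homg_eq => t; rewrite homgME /= thMl.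
- apply: morph_inj => [x y|w w1]; first by apply: homg_eq => t; rewrite homgME /= thMl.
  apply: th0 => v; have [t <-] := p_onto v.
  by have /(congr1 (fun f : homg T pm1 => f t)) := w1.
- move=> f; have [g gM gE] := homg_factor f; have [w wE] := thS g gM.
  by exists w; apply: homg_eq => t /=; rewrite wE gE.
- by move=> kt t; rewrite /= thk ?kE.
Qed.

Lemma homg_iso_quotient : group_iso (homg T pm1) W.
Proof.
have [th [thM thI thS _]] := quotient_dual 1%g 1%g.
exact/group_iso_sym/(group_isoP thM).
Qed.

(** The kernel of [h] is exactly the set of squares, so [h] embeds [W] into the characters of [T],
    and [quotient_dual] shows that there are as many characters as elements of [W]. *)
Lemma dual_onto (h : T -> homg T pm1) : {morph h : x y / (x * y)%g} ->
  (forall t, h t = 1%g -> exists s, t = (s * s)%g) -> forall f, exists t, h t = f.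
Proof.
move=> hM hK f; have [th [thM thI thS _]] := quotient_dual 1%g 1%g.
have [r rK] := choice p_onto; have [u uK] := choice thS.
have p1 := morph_mul1 pM; have h1 := morph_mul1 hM.
have h2 (s : T) : (h (s * s) = 1)%g by rewrite hM; apply: homg_eq => t; exact: pm1_sq.
have hr x t : p t = x -> h (r x) = h t.
  move=> tx; have /p_ker[s sE] : p (r x / t)%g = 1%g.
    by apply: (mulIg (p t)); rewrite -pM mulgVK rK mul1g.
  by rewrite -[r x](mulgVK t) sE hM h2 mul1g.
have lW (w : W) : w \in map p l by have [t <-] := p_onto w; apply/map_f.
(* Followed by the inverse of [th], the embedding becomes an injective map from the finite group [W]
   to itself. *)
pose g w := u (h (r w)).
have gI : injective g.
  apply: morph_inj => [x y|w].
    by apply: thI; rewrite thM !uK -hM; apply: hr; rewrite pM !rK.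
  move=> /(congr1 th); rewrite uK morph_mul1 // => /hK[s sE].
  by rewrite -(rK w); apply/p_ker; exists s.
have [|w gw] := uniq_inj_onto (undup_uniq (map p l)) (lb := undup (map p l)) _ gI (leqnn _) (u f).
  by move=> b; rewrite mem_undup.
by exists (r w); rewrite -(uK (h _)) -/(g w) gw uK.
Qed.

End DualOfQuotient.

(** * Graded division algebras *)

Lemma algAut_of_fun (F : fieldType) (A : falgType F) (f : A -> A) :
  linear f -> {morph f : x y / x * y} -> f 1 = 1 -> injective f ->
  exists h : algAut A, forall x, h x = f x.
Proof.
move=> fL fM f1 fI.
pose fl : {linear A -> A} := HB.pack f (GRing.isLinear.Build F A A _ f fL).
have E x : linfun fl x = f x by rewrite lfunE.
have fa : ahom_in {:A} (linfun fl).
  by apply/ahom_inP; split=> [x y _ _|]; rewrite !E ?fM ?f1.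
have fk : lker (AHom fa) == 0%VS by apply/lker0P => x y /=; rewrite !E => /fI.
by exists (AlgAut fk).
Qed.

Lemma algAutM (F : fieldType) (A : falgType F) (f g : algAut A) x :
  (f * g)%g x = f (g x).
Proof. by rewrite comp_lfunE. Qed.

Section GradedDivision.
Variables (F : fieldType) (G : abelGroupType) (D : falgType F).
Variable Gm : divGrading G D.
Local Notation T := (suppg Gm).
Local Notation Stab := (stabg Gm).

Lemma graded_indep (s : seq G) (v : G -> D) : uniq s ->
  (forall g, v g \in Gm g) -> \sum_(g <- s) v g = 0 -> {in s, forall g, v g = 0}.
Proof.
move=> us vG v0 g /seq_tnthP[i ->].
have : directv (\sum_(i < size s) Gm (tnth (in_tuple s) i))%VS.
  move: (hcomp_direct Gm us); rewrite !directvE /=.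
  by rewrite !(big_tnth _ _ s).
move/directv_sum_independent/(_ (fun i => v (tnth (in_tuple s) i))); apply=> //.
by rewrite -[RHS]v0 [RHS]big_tnth.
Qed.

Lemma supp_enum : exists l : seq T, [/\ uniq l, forall t, t \in l &
  {:D}%VS = (\sum_(t <- l) Gm (val t))%VS].
Proof.
have [s0 s0P] := supp_finite Gm; have [s1 s1P] := hcomp_span Gm.
pose l : seq T := undup (pmap insub s0).
have lP (t : T) : t \in l.
  by rewrite mem_undup mem_pmap_sub s0P // (valP t).
exists l; split=> //; first exact: undup_uniq.
apply/eqP; rewrite eqEsubv subvf andbT -s1P.
elim: s1 {s1P} => [|g s IH]; first by rewrite big_nil sub0v.
rewrite big_cons subv_add IH andbT.
have [->|g0] := eqVneq (Gm g) 0%VS; first exact: sub0v.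
by rewrite (big_rem _ (lP (Suppg (g0 : g \in supp Gm)))) addvSl.
Qed.

Lemma homog_ind (P : D -> Prop) : P 0 -> (forall x y, P x -> P y -> P (x + y)) ->
  (forall (t : T) x, x \in Gm (val t) -> P x) -> forall x, P x.
Proof.
move=> P0 PD PH x; have [l [_ _ lE]] := supp_enum.
have : x \in (\sum_(t <- l) Gm (val t))%VS by rewrite -lE memvf.
elim: l x {lE} => [|t l IH] x; first by rewrite big_nil memv0 => /eqP->.
by rewrite big_cons => /memv_addP[y yt [z /IH Pz ->]]; apply: PD => //; apply: PH yt.
Qed.

Lemma stab_homog (f : Stab) g x : x \in Gm g -> f x \in Gm g.
Proof. by move=> xg; have /asboolP/(_ g) <- := valP f; apply: memv_img. Qed.

Lemma stabM (f h : Stab) x : (f * h)%g x = f (h x).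
Proof. exact: (@algAutM _ _ (val f) (val h)). Qed.

Lemma stab_rmorphM (f : Stab) x y : f (x * y) = f x * f y.
Proof. exact: rmorphM. Qed.
Lemma stab_rmorph1 (f : Stab) : f 1 = 1.
Proof. exact: rmorph1. Qed.

Lemma stab_eq (f h : Stab) :
  (forall (t : T) x, x \in Gm (val t) -> f x = h x) -> f = h.
Proof.
move=> fh; apply/val_inj/algAutP; apply: homog_ind => [|x y|t x]; last exact: fh.
  by rewrite !linear0.
by rewrite !linearD => /= -> ->.
Qed.

(** Mapping each component into itself is enough, since an injective linear map preserves
    dimension. *)
Lemma stab_of_fun (f : D -> D) :
  linear f -> {morph f : x y / x * y} -> f 1 = 1 -> injective f ->
  (forall g x, x \in Gm g -> f x \in Gm g) -> exists h : Stab, forall x, h x = f x.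
Proof.
move=> fL fM f1 fI fG; have [h hE] := algAut_of_fun fL fM f1 fI.
have hS : h \in stab Gm.
  apply/asboolP => g; apply/eqP; rewrite eqEdim limg_dim_eq.
    by rewrite leqnn andbT; apply/subvP => _ /memv_imgP[x xg ->]; rewrite hE fG.
  by rewrite (eqP (algAut_ker h)) capv0.
by exists (Stabg hS).
Qed.

Lemma stab_inj (f : Stab) : injective f.
Proof. exact/lker0P/algAut_ker. Qed.

Lemma homogM g h x y : x \in Gm g -> y \in Gm h -> x * y \in Gm (g * h)%g.
Proof. by move=> xg yh; apply: (subvP (hcompM Gm g h)); apply: memv_mul. Qed.

(** The automorphism is the sum of the projections onto the components with the signs [c t]. It is
    an involution, hence injective. *)
Lemma stab_of_char (c : homg T pm1) : exists f : Stab,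
  forall (t : T) x, x \in Gm (val t) -> f x = (val (c t))%:~R *: x.
Proof.
have [l [ul lP lE]] := supp_enum.
pose p t := sumv_pi_for lE t.
have p_sum x : \sum_(t <- l) p t x = x.
  by apply: sumv_pi_uniq_sum (memvf x); rewrite filter_predT.
have p_id t x : x \in Gm (val t) -> forall s, p s x = (s == t)%:R *: x.
  move=> xt s; apply/eqP; rewrite -subr_eq0; apply/eqP.
  have ulG : uniq (map val l) by rewrite map_inj_uniq //; exact: val_inj.
  (* The family for [graded_indep] is indexed by [G]; outside the support it is 0. *)
  pose v (g : G) := if insub g is Some s then p s x - (s == t)%:R *: x else 0.
  have vE (r : T) : v (val r) = p r x - (r == t)%:R *: x by rewrite /v valK.
  rewrite -vE; apply: (graded_indep (v := v) ulG) => [g||].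
  - rewrite /v; case: (@insubP _ _ T g) => [r _ <-|_]; last exact: mem0v.
    rewrite memvB ?memv_sum_pi //; case: eqP => [->|_]; rewrite ?scale1r //.
    by rewrite scale0r mem0v.
  - rewrite big_map (eq_bigr (fun r => p r x - (r == t)%:R *: x)) //.
    rewrite sumrB p_sum (bigD1_seq t) //= eqxx scale1r big1 ?addr0 ?subrr // => r /negPf->.
    by rewrite scale0r.
  - by rewrite map_f.
pose k t : F := (val (c t))%:~R.
have kM s t : k (s * t)%g = k s * k t by rewrite /k homgM unitsM intrM.
have k2 t : k t * k t = 1 by rewrite -kM /k homgM pm1_sq.
pose f x := \sum_(t <- l) k t *: p t x.
have fH t x : x \in Gm (val t) -> f x = k t *: x.
  move=> xt; rewrite /f (bigD1_seq t) //= (p_id t) // eqxx scale1r big1 ?addr0 // => r /negPf rt.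
  by rewrite (p_id t) // rt scale0r scaler0.
have fL : linear f.
  move=> a x y; rewrite /f scaler_sumr -big_split; apply: eq_bigr => t _ /=.
  by rewrite linearP scalerDr !scalerA mulrC.
have fD x y : f (x + y) = f x + f y by rewrite -[x]scale1r fL !scale1r.
have f0 : f 0 = 0 by apply: (addIr (f 0)); rewrite -fD !add0r.
have ff x : f (f x) = x.
  elim/homog_ind: x => [|x y Px Py|t x xt]; rewrite ?f0 //; first by rewrite !fD Px Py.
  by rewrite (fH t x xt) (fH t) ?memvZ // scalerA k2 scale1r.
have fM : {morph f : x y / x * y}.
  move=> x y; elim/homog_ind: x => [|x x' Px Px'|s x xs].
  - by rewrite f0 !mul0r f0.
  - by rewrite mulrDl !fD Px Px' mulrDl.
  elim/homog_ind: y => [|y y' Py Py'|t y yt].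
  - by rewrite f0 !mulr0 f0.
  - by rewrite mulrDr !fD Py Py' mulrDr.
  by rewrite (fH s x) // (fH t y) // (fH (s * t)%g) ?homogM // kM -scalerAl -scalerAr scalerA.
have fG g x : x \in Gm g -> f x \in Gm g.
  have [->|x0] := eqVneq x 0; first by rewrite f0 mem0v.
  move=> xg; have gs : g \in supp Gm.
    by rewrite inE; apply: contraNneq x0 => g0; move: xg; rewrite g0 memv0.
  by rewrite (fH (Suppg gs)) // memvZ.
(* [f 1 = f (f 1) * f 1 = f (f 1 * 1) = 1]. *)
have f1 : f 1 = 1 by rewrite -[f 1]mul1r -{1}[1]ff -fM mulr1 ff.
have [h hE] := stab_of_fun fL fM f1 (can_inj ff) fG.
by exists h => t x xt; rewrite hE (fH t).
Qed.

Variable d : nat.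
Hypothesis dimG : {in supp Gm, forall g, \dim (Gm g) = d}.

Lemma dim_comp (t : T) : \dim (Gm (val t)) = d.
Proof. exact/dimG/valP. Qed.

Lemma supp1 : 1%g \in supp Gm.
Proof. exact: (supp_closed Gm).1. Qed.

(** Multiplication by the unit [x] preserves dimension, and all nonzero components have dimension
    [d]. Hence homogeneous elements of equal degree differ by a factor in [D_e]. *)
Lemma comp_coset (s t : T) x : x \in Gm (val s) -> x != 0 ->
  (Gm (val t) * <[x]>)%VS = Gm (val (t * s)%g).
Proof.
move=> xs x0; apply/eqP; rewrite eqEdim dim_cosetv_unit ?(hcomp_unit xs) //.
rewrite !dim_comp leqnn andbT; apply/prodvP => u _ ut /vlineP[k ->].
by rewrite -scalerAr memvZ // homogM.
Qed.

Lemma homog_div (t : T) x y : x \in Gm (val t) -> x != 0 -> y \in Gm (val t) ->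
  exists2 e, e \in Gm 1%g & y = e * x.
Proof.
move=> xt x0 yt; apply/memv_cosetP.
by rewrite (comp_coset 1%g xt x0) mul1g.
Qed.

(** A nonzero element of [D_e] is a multiple of itself by some [e] in [D_e]; cancelling it gives
    [e = 1]. *)
Lemma homog1 : 1 \in Gm 1%g.
Proof.
have x1 := memv_pick (Gm 1%g); have x0 : vpick (Gm 1%g) != 0 by rewrite vpick0; exact: supp1.
have [e e1 /esym eE] := homog_div (t := 1%g) x1 x0 x1.
have ux := hcomp_unit x1 x0.
by have <- : e = 1 by apply: (mulIr ux); rewrite eE mul1r.
Qed.

Lemma homogV (t : T) x : x \in Gm (val t) -> x != 0 -> x^-1 \in Gm (val t^-1)%g.
Proof.
move=> xt x0; have : 1 \in (Gm (val t^-1%g) * <[x]>)%VS.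
  by rewrite (comp_coset _ xt x0) mulVg homog1.
case/memv_cosetP => u ut u1; have ux := hcomp_unit xt x0.
by have -> : x^-1 = u by apply: (mulIr ux); rewrite mulVr.
Qed.

(** Conjugation by a homogeneous element preserves degrees because [G] is abelian. *)
Lemma stab_inner (t : T) u : u \in Gm (val t) -> u != 0 ->
  exists f : Stab, forall x, f x = u * x * u^-1.
Proof.
move=> ut u0; have uu := hcomp_unit ut u0; apply: stab_of_fun.
- by move=> a x y; rewrite mulrDr mulrDl -!scalerAr -scalerAl.
- by move=> x y; rewrite !mulrA mulrVK.
- by rewrite mulr1 divrr.
- have uu' : u^-1 \is a GRing.unit by rewrite unitrV.
  by move=> x y /(mulIr uu')/(mulrI uu).
- move=> g x xg; have := homogM (homogM ut xg) (homogV ut u0).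
  by rewrite (mulgC (val t)) -mulgA -[(val t * _)%g]/(val (t * t^-1)%g) mulgV mulg1.
Qed.

Lemma homog_free (s : seq T) (y : T -> D) : uniq s ->
  (forall t, y t \in Gm (val t)) -> (forall t, y t != 0) -> free (map y s).
Proof.
move=> us yG y0; have ulG : uniq (map val s) by rewrite map_inj_uniq //; exact: val_inj.
suff : free (in_tuple (map y s)) by [].
apply/freeP => k kE i.
have szi : (i < size s)%N by rewrite -(size_map y) ltn_ord.
pose v (g : G) := if insub g is Some t then (if insub (index t s) is Some j then k j else 0) *: y t else 0.
have vE (r : 'I_(size (map y s))) : v (val (nth 1%g s r)) = k r *: y (nth 1%g s r).
  have szr : (r < size s)%N by rewrite -(size_map y) ltn_ord.
  by rewrite /v valK index_uniq // valK.
have : v (val (nth 1%g s i)) = 0.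
  apply: (graded_indep (v := v) ulG) => [g||]; last by rewrite map_f ?mem_nth.
    rewrite /v; case: (@insubP _ _ T g) => [t _ <-|_]; last exact: mem0v.
    by rewrite memvZ ?yG.
  rewrite big_map (big_nth 1%g) -[RHS]kE big_mkord -(size_map y); apply: eq_bigr => j _.
  have szj : (j < size s)%N by rewrite -(size_map y) ltn_ord.
  by rewrite vE (nth_map 1%g).
by rewrite vE => /eqP; rewrite scaler_eq0 (negPf (y0 _)) orbF => /eqP.
Qed.

End GradedDivision.

(** * Centers and characters *)

(** Compare the entries of [M] times a matrix unit and of the matrix unit times [M], then commute
    with scalar matrices. *)
Lemma central_matrix (B : nzRingType) n (M : 'M[B]_n.+1) :
  (forall N, M * N = N * M) -> exists2 b, M = b%:M & forall c, b * c = c * b.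
Proof.
move=> cM; have E i j k : M k i = if k == i then M j j else 0.
  have /matrixP/(_ k j) := cM (delta_mx i j).
  rewrite !mxE (bigD1 i) //= big1 ?addr0 => [|l /negPf li]; last first.
    by rewrite mxE li mulr0.
  rewrite mxE !eqxx mulr1 => ->; rewrite (bigD1 j) //= big1 ?addr0 => [|l /negPf lj]; last first.
    by rewrite mxE lj andbF mul0r.
  by rewrite mxE eqxx andbT; case: eqP => _; rewrite ?mul1r ?mul0r.
have ME : M = (M 0 0)%:M.
  by apply/matrixP => k i; rewrite (E i 0 k) mxE; case: eqP.
exists (M 0 0) => // c; have := cM c%:M.
rewrite ME -!mulmxE -!scalar_mxM => /matrixP/(_ 0 0).
by rewrite !mxE eqxx !mulr1n.
Qed.

(** Central matrices are scalar with a central entry, so if [X] spans the center of [B], the scalar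
    matrices on [X] span the center of [D]. *)
Lemma center_bound (F : fieldType) (B : lalgType F) (D : falgType F) (X : seq B) :
  matrix_algebra_iso B D ->
  (forall b : B, (forall c, b * c = c * b) ->
     exists k : 'I_(size X) -> F, b = \sum_i k i *: X`_i) ->
  (\dim 'Z({:D}) <= size X)%N.
Proof.
move=> [n [f [[g fK gK] fZ]]] Xb.
suff sub : ('Z({:D}) <= <<map (fun b => g b%:M) X>>)%VS.
  by rewrite (leq_trans (dimvS sub)) // (leq_trans (dim_span _)) ?size_map.
apply/subvP => z; rewrite memv_cap memvf => /centvP cz.
have [N|b zb /Xb[k bE]] := @central_matrix _ _ (f z).
  by rewrite -(gK N) -!rmorphM cz ?memvf.
have -> : z = \sum_i k i *: g (X`_i)%:M.
  apply: (can_inj fK); rewrite zb bE [in RHS]raddf_sum raddf_sum /=; apply: eq_bigr => i _.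
  by rewrite fZ gK scale_scalar_mx mulr_algl.
apply: memv_suml => i _; apply/memvZ/memv_span.
by apply: (map_f (fun b => g b%:M)); rewrite mem_nth.
Qed.

Section Pm1Real.
Variable R : realType.

Definition pmr (e : pm1) : R := (val e)%:~R.

Lemma pmrM e f : pmr (e * f)%g = pmr e * pmr f.
Proof. by rewrite /pmr unitsM intrM. Qed.
Lemma pmr_inj : injective pmr.
Proof. by move=> e f /eqP; rewrite eqr_int => /eqP/val_inj. Qed.

(** A real root of unity has absolute value 1. *)
Lemma pmr_of_root (c : R) n : c ^+ n.+1 = 1 -> exists e, pmr e = c.
Proof.
move=> cn; have : `|c| == 1.
  by rewrite -(@pexpr_eq1 _ _ n.+1) // -normrX cn normr1.
rewrite eqr_norml ler01 andbT => /orP[] /eqP ->; first by exists 1%g.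
by exists (pmb true).
Qed.

Lemma pmr_char (T : groupType) (l : seq T) (c : T -> R) : (forall t, t \in l) ->
  {morph c : s t / (s * t)%g >-> s * t} -> c 1%g = 1 ->
  exists f : homg T pm1, forall t, c t = pmr (f t).
Proof.
move=> lP cM c1; have cX t n : c (t ^+ n)%g = c t ^+ n.
  by elim: n => [|n IH]; rewrite ?expg0 ?c1 ?expr0 // expgS cM IH exprS.
have /choice[f fE] t : exists e, pmr e = c t.
  have [n tn] := finite_order t lP; apply: (@pmr_of_root _ n).
  by rewrite -cX tn c1.
have fM : `[< {morph f : x y / (x * y)%g} >].
  by apply/asboolP => x y; apply: pmr_inj; rewrite pmrM !fE cM.
by exists (Homg fM) => t; rewrite /= fE.
Qed.

End Pm1Real.

Section Quotients.
Variable T : abelGroupType.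

Lemma cosetgM : {morph cosetg (squares T) : x y / (x * y)%g}.
Proof. by move=> x y; rewrite /cosetg -quotg_mulE. Qed.
Lemma cosetg_onto w : exists t, cosetg (squares T) t = w.
Proof. by exists (repr w); apply: reprK. Qed.
Lemma cosetg_ker t : cosetg (squares T) t = 1%g <-> exists s, t = (s * s)%g.
Proof.
rewrite /cosetg; split=> [/pi_eqP|tE]; first by rewrite divg1 => /asboolP.
by apply/pi_eqP; rewrite divg1; apply/asboolP.
Qed.

End Quotients.

(** * The real twisted group ring spanned by the [y t], and its characters *)

Section RealForm.
Variables (R : realType) (G : abelGroupType) (D : falgType R).
Variables (Gm : divGrading G D) (d : nat).
Hypothesis dimG : components_dim Gm d.
Local Notation T := (suppg Gm).
Local Notation Stab := (stabg Gm).
Variable y : T -> D.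
Hypotheses (yG : forall t, y t \in Gm (val t)) (y0 : forall t, y t != 0).
Hypothesis yM : forall s t, exists r : R, y s * y t = r *: y (s * t)%g.

Lemma y_unit t : y t \is a GRing.unit.
Proof. exact: hcomp_unit (yG t) (y0 t). Qed.

Lemma yM_neq0 s t : exists2 r : R, r != 0 & y s * y t = r *: y (s * t)%g.
Proof.
have [r rE] := yM s t; exists r => //; apply: contraTneq (y_unit s) => r0.
apply/negP => us; have : y s * y t \is a GRing.unit by rewrite unitrMl // y_unit.
by rewrite rE r0 scale0r unitr0.
Qed.

(** Applying [f] to [y s * y t = r *: y (s * t)] with [r] nonzero makes the eigenvalues
    multiplicative, and a real character of a finite group consists of signs. *)
Lemma eigen_char (f : Stab) : (forall t, exists c : R, f (y t) = c *: y t) ->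
  exists k : homg T pm1, forall t, f (y t) = pmr R (k t) *: y t.
Proof.
move=> /choice[c cE]; have [l [_ lP _]] := supp_enum Gm.
have yI (a b : R) t : a *: y t = b *: y t -> a = b.
  move=> /eqP; rewrite -subr_eq0 -scalerBl scaler_eq0 (negPf (y0 t)) orbF subr_eq0.
  by move/eqP.
have c0 t : c t != 0.
  apply: contra (y0 t) => /eqP c0; apply/eqP/(@stab_inj _ _ _ _ f).
  by rewrite cE c0 scale0r linear0.
have cM : {morph c : s t / (s * t)%g >-> s * t}.
  move=> s t; have [r r0 rE] := yM_neq0 s t.
  have := stab_rmorphM f (y s) (y t); rewrite !cE rE linearZ /= cE.
  rewrite -scalerAl -scalerAr rE !scalerA => /yI/eqP; rewrite mulrC (inj_eq (mulIf r0)).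
  by move/eqP.
have c1 : c 1%g = 1.
  by apply: (mulfI (c0 1%g)); rewrite -cM mulg1 mulr1.
have [k kE] := pmr_char lP cM c1.
by exists k => t; rewrite cE kE.
Qed.

Lemma eigen_char_inj (k k' : homg T pm1) :
  (forall t, pmr R (k t) *: y t = pmr R (k' t) *: y t) -> k = k'.
Proof.
move=> kk; apply: homg_eq => t; apply: (@pmr_inj R); apply/eqP.
rewrite -subr_eq0; have /eqP := kk t.
by rewrite -subr_eq0 -scalerBl scaler_eq0 (negPf (y0 t)) orbF.
Qed.

Lemma eigen_hom : (forall (f : Stab) t, exists c : R, f (y t) = c *: y t) ->
  exists2 P : Stab -> homg T pm1, {morph P : f g / (f * g)%g} &
    forall (f : Stab) t, f (y t) = pmr R (P f t) *: y t.
Proof.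
move=> /(fun H f => eigen_char (H f))/choice[P PE]; exists P => // f g.
apply: eigen_char_inj => t; rewrite -PE stabM !PE linearZ /= PE.
by rewrite scalerA pmrM mulrC.
Qed.

Variable Psi : Stab -> homg T pm1.
Hypothesis PsiM : {morph Psi : f g / (f * g)%g}.
Hypothesis Psi_inner : forall t (f : Stab),
  (forall x, f x = y t * x * (y t)^-1) -> Psi f = 1%g -> forall x, y t * x = x * y t.

(** The scalar [r] in [y s * y t = r *: y (s * t)] cancels in a conjugation. *)
Lemma inner_chars : exists2 I : T -> Stab,
  forall t x, I t x = y t * x * (y t)^-1 & {morph (fun t => Psi (I t)) : s t / (s * t)%g}.
Proof.
have [I IE] := choice (fun t => stab_inner dimG (yG t) (y0 t)).
exists I => // s t; rewrite -PsiM; congr (Psi _); apply/val_inj/algAutP => x.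
rewrite IE [RHS]stabM !IE; have [r r0 rE] := yM_neq0 s t.
have -> : y (s * t)%g = r^-1 *: (y s * y t) by rewrite rE scalerA mulVf // scale1r.
rewrite invrZ ?unitrV ?unitfE ?invr_eq0 ?unitrMl ?y_unit // invrK.
by rewrite -!scalerAl -scalerAr scalerA mulVf // scale1r invrM ?y_unit // !mulrA.
Qed.

(** For [t] in the kernel the [y t] are central, and they are linearly independent, having distinct
    degrees. *)
Lemma inner_chars_ker (I : T -> Stab) (s : seq T) :
  (forall t x, I t x = y t * x * (y t)^-1) -> uniq s ->
  {in s, forall t, Psi (I t) = 1%g} -> (size s <= \dim 'Z({:D}))%N.
Proof.
move=> IE us sK; have := homog_free us yG y0; rewrite /free size_map => /eqP <-.
apply: dimvS; apply/span_subvP => _ /mapP[t ts ->].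
rewrite memv_cap memvf; apply/centvP => x _.
exact: (Psi_inner (IE t) (sK t ts)).
Qed.

Lemma char_square (I : T -> homg T pm1) t :
  {morph I : s t / (s * t)%g} -> I (t * t)%g = 1%g.
Proof. by move=> IM; rewrite IM; apply: homg_eq => s; exact: pm1_sq. Qed.

(** Both [1] and [t * t] lie in the kernel, which has at most one element. *)
Lemma supp_elementary : (\dim 'Z({:D}) <= 1)%N -> forall t : T, (t * t = 1)%g.
Proof.
move=> Z1 t; have [I IE IM] := inner_chars.
have [//|/eqP t1] := pselect (t * t = 1)%g.
have := @inner_chars_ker I [:: 1; t * t]%g IE; rewrite /= inE eq_sym t1.
move=> /(_ erefl) H; have /leq_trans/(_ Z1) : (2 <= \dim 'Z({:D}))%N; last by [].
apply: H => s; rewrite !inE => /orP[]/eqP->; first exact: (morph_mul1 IM).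
exact: char_square IM.
Qed.

Hypothesis Psi_ker : forall f, Psi f = 1%g -> inner_aut (val f).

(** The kernel of [t |-> Psi (I t)] consists of squares, so [dual_onto] finds [t] with
    [Psi (I t) = Psi f]. Then [f / I t] lies in the kernel of [Psi], hence is inner. *)
Lemma all_inner_of_center : (\dim 'Z({:D}) <= 2)%N ->
  ~ (forall t : T, (t * t = 1)%g) -> forall f : Stab, inner_aut (val f).
Proof.
move=> Z2 nel f; have [I IE IM] := inner_chars; have [l [_ lP _]] := supp_enum Gm.
(* The kernel has at most two elements, and [1] and some [a * a] other than 1 are already two. *)
have hK t : Psi (I t) = 1%g -> exists s, t = (s * s)%g.
  move=> t1; have [a a2] : exists a : T, (a * a)%g <> 1%g.
    by apply/existsNP.
  have [->|/eqP nt1] := pselect (t = 1%g); first by exists 1%g; rewrite mulg1.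
  have [->|/eqP nta] := pselect (t = a * a)%g; first by exists a.
  have := @inner_chars_ker I [:: 1; a * a; t]%g IE.
  rewrite /= !inE negb_or ![1%g == _]eq_sym nt1 [(a * a)%g == t]eq_sym nta.
  have -> : (a * a)%g != 1%g by apply/eqP.
  move=> /(_ erefl) H; have /leq_trans/(_ Z2) : (3 <= \dim 'Z({:D}))%N; last by [].
  apply: H => s; rewrite !inE => /or3P[]/eqP->; first exact: (morph_mul1 IM).
    exact: char_square IM.
  by [].
have [t tE] := dual_onto lP (@cosetgM T) (@cosetg_onto T) (@cosetg_ker T) IM hK (Psi f).
have [u uu uE] : inner_aut (val (f / I t)%g).
  apply: Psi_ker; apply: (mulIg (Psi (I t))).
  by rewrite -PsiM mulgVK mul1g tE.
exists (u * y t) => [|x]; first by rewrite unitrMl ?y_unit.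
have -> : val f = val ((f / I t) * I t)%g by rewrite mulgVK.
rewrite [LHS](stabM (f / I t)%g (I t)) [LHS]uE IE invrM ?y_unit //.
by rewrite !mulrA.
Qed.

End RealForm.

(** * Quadratic elements of real division algebras *)

Section CenterTypes.
Variables (R : realType) (D : falgType R).

Lemma center_MnR : is_MnR D -> (\dim 'Z({:D}) <= 1)%N.
Proof.
move=> /(@center_bound _ _ _ [:: 1]); apply=> b _.
by exists (fun=> b); rewrite big_ord1 /= [_ *: _]mulr1.
Qed.

Lemma center_MnH : is_MnH D -> (\dim 'Z({:D}) <= 1)%N.
Proof.
move=> /(@center_bound _ _ _ [:: 1]); apply=> -[a b c e] cen.
have [_ _ + +] := cen (Quat 0 1 0 0); have [_ _ _ +] := cen (Quat 0 0 1 0).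
move=> e0 e1 c0; exists (fun=> a); rewrite big_ord1 /=.
have -> : (1 : quat R) = Quat 1 0 0 0 by [].
by congr Quat; lra.
Qed.

Lemma center_MnC : is_MnC D -> (\dim 'Z({:D}) <= 2)%N.
Proof.
move=> /(@center_bound _ _ _ [:: 1; ('i%C : Rcomplex R)]); apply=> -[a b] _.
exists (fun i => if i == ord0 then a else b); rewrite big_ord_recl big_ord1 /=.
by apply/eqP; rewrite eq_complex /= !mulr0 !mulr1 addr0 add0r !eqxx.
Qed.

End CenterTypes.

(** * Division subalgebras [V]: quadratic equations and imaginary units *)

Section Quadratic.
Variables (R : realType) (A : falgType R) (V : {vspace A}).
Hypotheses (V1 : 1 \in V) (VM : {in V &, forall x y, x * y \in V}).
Hypothesis VU : {in V, forall x, x != 0 -> x \is a GRing.unit}.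

(** More powers of [y] than the dimension of the algebra are linearly dependent. *)
Lemma annihilating_poly (y : A) : exists2 p : {poly R}, p != 0 & horner_alg y p = 0.
Proof.
apply: contrapT => no; pose n := (\dim {:A}).+1.
have : free [tuple y ^+ (i : nat) | i < n].
  apply/freeP => k kE i; pose p := \poly_(j < n) (if insub j is Some i' then k i' else 0).
  have p0 : p = 0.
    apply/eqP/negPn/negP => p0; apply: no; exists p => //.
    rewrite -[RHS]kE /p poly_def raddf_sum; apply: eq_bigr => j _ /=.
    rewrite valK linearZ /= rmorphXn /= horner_algX.
    by rewrite (nth_map j) ?size_enum_ord ?ltn_ord // nth_ord_enum mulr_algl.
  by have := coef_poly n (fun j => if insub j is Some i' then k i' else 0) i; rewrite -/p p0 coef0 ltn_ord valK => <-.
rewrite /free size_tuple => /eqP E.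
by have := dimvS (subvf <<[tuple y ^+ (i : nat) | i < n]>>); rewrite E ltnn.
Qed.

Lemma horner_alg_mem y p : y \in V -> horner_alg y p \in V.
Proof.
move=> yV; elim/poly_ind: p => [|p c IH]; first by rewrite rmorph0 mem0v.
by rewrite rmorphD rmorphM /= horner_algX horner_algC memvD ?memvZ ?VM.
Qed.

(** By induction on the degree of an annihilating [p]: a complex root [a + b i] of [p] yields the
    real factor [X - a] or [(X - a)^2 + b^2]. *)
Lemma quadratic (y : A) : y \in V -> exists a b : R, (y - a%:A) ^+ 2 = - (b ^+ 2)%:A.
Proof.
move=> yV; have [p p0 py] := annihilating_poly y.
have [n] := ubnP (size p); elim: n p p0 py => // n IH p p0 py szp.
have [sz1|sz1] := eqVneq (size p) 1%N.
  have /size1_polyC pE : (size p <= 1)%N by rewrite sz1.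
  move: py; rewrite pE horner_algC => /eqP; rewrite scaler_eq0 oner_eq0 orbF => /eqP c0.
  by move: p0; rewrite pE c0 eqxx.
have : size (map_poly (real_complex R) p) != 1%N by rewrite size_map_poly.
case/closed_rootP => -[a b] /eqP rootz.
pose q := ('X - a%:P) ^+ 2 + (b ^+ 2)%:P : {poly R}.
(* At [y] the cofactor [r] either vanishes, and the induction applies to it, or is invertible, and
   then [s] vanishes at [y]. *)
have step r s : p = r * s -> (1 < size s)%N -> horner_alg y s = 0 \/ exists a b : R, (y - a%:A) ^+ 2 = - (b ^+ 2)%:A.
  move=> pE szs; have [r0|r0] := eqVneq (horner_alg y r) 0.
    right; apply: (IH r) => //.
      by apply: contraNneq p0 => r00; rewrite pE r00 mul0r.
    have rn0 : r != 0 by apply: contraNneq p0 => r00; rewrite pE r00 mul0r.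
    have sn0 : s != 0 by apply: contraNneq p0 => r00; rewrite pE r00 mulr0.
    move: szp; rewrite pE size_mul // => szp; rewrite -ltnS; apply: leq_trans szp.
    by case: (size s) szs => [|[|m]] // _; rewrite !addnS /= ltnS leq_addr.
  left; apply: (mulrI (VU (horner_alg_mem r yV) r0)).
  by rewrite mulr0 -[RHS]py pE rmorphM.
have qE : horner_alg y q = (y - a%:A) ^+ 2 + (b ^+ 2)%:A.
  by rewrite rmorphD rmorphXn rmorphB /= horner_algX !horner_algC.
have [b0|b0] := eqVneq b 0.
  have /factor_theorem[r rE] : root p a.
    move: rootz; rewrite b0 -[(a +i* 0)%C]/(real_complex R a) horner_map /= => -[pa].
    by apply/eqP.
  have [| |//] := step _ _ rE; first by rewrite size_XsubC.
  rewrite rmorphB /= horner_algX horner_algC => ya.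
  by exists a, 0; rewrite ya !expr0n /= scale0r oppr0.
have szq : size q = 3%N.
  by rewrite size_addl size_exp_XsubC // (leq_ltn_trans (size_polyC_leq1 _)).
(* The remainder is real of degree at most 1 and has the nonreal root [a + b i]. *)
have rem0 : p %% q = 0.
  have : (size (p %% q)%R <= 2)%N by rewrite -ltnS -szq ltn_modp -size_poly_gt0 szq.
  move: rootz; rewrite {1}(divp_eq p q).
  rewrite rmorphD rmorphM /= hornerD hornerM.
  have -> : (map_poly (real_complex R) q).[(a +i* b)%C] = 0.
    rewrite rmorphD rmorphXn rmorphB /= map_polyX !map_polyC /= !hornerE.
    by apply/eqP; rewrite eq_complex /=; apply/andP; split; apply/eqP; ring.
  rewrite mulr0 add0r; move: (p %% q) => m mz szm.
  have mE : m = (m`_1)%:P * 'X + (m`_0)%:P.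
    apply/polyP => i; rewrite coefD coefMX !coefC.
    case: i => [|[|i]]; rewrite ?add0r ?addr0 //=.
    by rewrite nth_default // (leq_trans szm).
  move: mz; rewrite mE rmorphD rmorphM /= map_polyX !map_polyC /= !hornerE /=.
  case=> e1 e2; have m1 : m`_1 = 0.
    have /eqP : m`_1 * b = 0 by move: e2; rewrite mul0r !addr0.
    by rewrite mulf_eq0 (negPf b0) orbF => /eqP.
  have m0 : m`_0 = 0. by move: e1; rewrite m1 !(mul0r, add0r, subr0, addr0, oppr0).
  by rewrite m1 m0 mul0r addr0.
have pE : p = p %/ q * q by rewrite {1}(divp_eq p q) rem0 addr0.
have [|q0|//] := step _ _ pE; first by rewrite szq.
by exists a, b; apply/eqP; rewrite -addr_eq0 -qE q0.
Qed.

(** If [b] were 0, then [y - a] would be nilpotent, hence 0, and [y] would be real. *)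
Lemma imaginary_unit (y : A) : y \in V -> y \notin <[1]>%VS ->
  exists a b : R, b != 0 /\ (b^-1 *: (y - a%:A)) ^+ 2 = - 1.
Proof.
move=> yV y1; have [a [b E]] := quadratic yV; exists a, b.
have b0 : b != 0.
  apply: contra y1 => /eqP b0; have [ya|ya] := eqVneq (y - a%:A) 0.
    by rewrite (subr0_eq ya) memvZ // memv_line.
  have ym : y - a%:A \in V by rewrite memvB // memvZ.
  move: E; rewrite b0 expr0n /= scale0r oppr0 => E.
  have := unitrX 2 (VU ym ya); by rewrite E unitr0.
split=> //; rewrite exprZn E scalerN scalerA -exprMn mulVf // expr1n.
by rewrite scale1r.
Qed.

Lemma exists_imaginary_unit : (1 < \dim V)%N -> exists2 i, i \in V & i * i = - 1.
Proof.
move=> dV; have /subvPn[y yV y1] : ~~ (V <= <[1]>)%VS.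
  by apply: contraL dV => /dimvS; rewrite dim_vline oner_eq0 -leqNgt.
have [a [b [b0 E]]] := imaginary_unit yV y1.
exists (b^-1 *: (y - a%:A)); last by rewrite -expr2.
by rewrite memvZ // memvB // memvZ.
Qed.

(** With [z = y - a], both [z] and [b i] have square [- b^2]. They commute, so the product of
    [z - b i] and [z + b i] is 0. *)
Lemma commuting_complex (i y : A) : i \in V -> i * i = - 1 -> y \in V -> i * y = y * i ->
  exists a b : R, y = a%:A + b *: i.
Proof.
move=> iV ii yV iy; have [a [b E]] := quadratic yV.
have [z zE] : exists z, z = y - a%:A by exists (y - a%:A).
have zi : i * z = z * i by rewrite zE mulrBr mulrBl iy -scalerAr -scalerAl mulr1 mul1r.
have zV : z \in V by rewrite zE memvB // memvZ.
have zz : z * z = - (b ^+ 2)%:A by rewrite zE -expr2.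
have F : (z - b *: i) * (z + b *: i) = 0.
  rewrite mulrDr !mulrBl -!scalerAl -!scalerAr zi zz scalerA ii scalerN -expr2.
  by rewrite opprK addrA subrK addNr.
have [z0|z0] := eqVneq (z - b *: i) 0.
  by exists a, b; rewrite -(subr0_eq z0) zE addrC subrK.
exists a, (- b); apply/eqP; rewrite scaleNr -subr_eq opprK -subr_eq0 addrAC -zE; apply/eqP.
apply: (mulrI (VU _ z0)); last by rewrite mulr0.
by rewrite memvB // memvZ.
Qed.

End Quadratic.

(** * Quaternions *)

Section Quaternions.
Variables (R : realType) (A : falgType R).

Lemma eq_oppr_eq0 (x : A) : x = - x -> x = 0.
Proof.
move=> xN; have : 2%:R *: x = 0 by rewrite scaler_nat mulr2n {2}xN subrr.
by move=> /eqP; rewrite scaler_eq0 pnatr_eq0 => /eqP.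
Qed.

Definition quat_pair (i j : A) := [/\ i * i = -1, j * j = -1 & j * i = - (i * j)].

(* [x - i' x i] intertwines [i] and [i']; if it vanishes then [i' x = - x i], and
   [x j] does. Then the same for [j], with [i] in the role of [j]. *)
Lemma quat_intertwiner (V : {vspace A}) (i j i' j' x : A) :
  quat_pair i j -> quat_pair i' j' -> {in V, forall z, i' * z \in V} ->
  {in V, forall z, j' * z \in V} -> {in V, forall z, z * i \in V} ->
  {in V, forall z, z * j \in V} -> x \in V -> x != 0 ->
  exists2 u, u \in V /\ u != 0 & i' * u = u * i /\ j' * u = u * j.
Proof.
move=> [ii jj ji] [ii' jj' ji'] Vi' Vj' Vi Vj xV x0.
have nz0 (a z : A) : a * a = -1 -> z != 0 -> z * a != 0.
  move=> aa; apply: contra => /eqP za; apply/eqP.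
  by apply: oppr_inj; rewrite oppr0 -mulrN1 -aa mulrA za mul0r.
have [w [wV w0 iw]] : exists w, [/\ w \in V, w != 0 & i' * w = w * i].
  have [E|E] := eqVneq (x - i' * x * i) 0.
    have xi : i' * x = - (x * i).
      by rewrite {1}(subr0_eq E) !mulrA ii' mulN1r mulNr.
    exists (x * j); split; [exact: Vj|exact: nz0|].
    by rewrite mulrA xi mulNr -!mulrA ji mulrN ?opprK.
  exists (x - i' * x * i); split=> //; first by rewrite memvB ?Vi ?Vi'.
  by rewrite mulrBr mulrBl !mulrA ii' mulN1r mulNr opprK -(mulrA _ i i) ii mulrN1 opprK addrC.
have [E|E] := eqVneq (w - j' * w * j) 0.
  have wj : j' * w = - (w * j).
    by rewrite {1}(subr0_eq E) !mulrA jj' mulN1r mulNr.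
  exists (w * i); first (split; [exact: Vi|exact: nz0]); split.
    by rewrite mulrA iw.
  by rewrite mulrA wj mulNr -!mulrA ji mulrN opprK.
exists (w - j' * w * j); [split=> //; first by rewrite memvB ?Vj ?Vj'|split].
  rewrite mulrBr mulrBl iw; congr (_ - _).
  by rewrite -[RHS]mulrA ji mulrN !mulrA -[i' * j']opprK -ji' !mulNr -(mulrA j') iw !mulrA.
by rewrite mulrBr mulrBl !mulrA jj' mulN1r mulNr opprK -(mulrA _ j j) jj mulrN1 opprK addrC.
Qed.

(** * Quaternion units in a real division algebra of dimension above 2 *)

Section Frobenius.
Variable V : {vspace A}.
Hypotheses (V1 : 1 \in V) (VM : {in V &, forall x y, x * y \in V}).
Hypothesis VU : {in V, forall x, x != 0 -> x \is a GRing.unit}.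

(** For [x] outside the span of [1] and [i], the element [b = x + i x i] is nonzero and anticommutes
    with [i]. Its square is a negative real, so a multiple of [b] serves as [j]. *)
Lemma exists_quat_pair : (2 < \dim V)%N ->
  exists i j, [/\ i \in V, j \in V & quat_pair i j].
Proof.
move=> dV; have [i iV ii] := exists_imaginary_unit V1 VM VU (ltnW dV).
have /subvPn[x xV xs] : ~~ (V <= <<[:: 1%R : A; i]>>)%VS.
  by apply: contraL dV => /dimvS le; rewrite -leqNgt (leq_trans le) ?dim_span.
have [b bdef] : exists b, b = x + i * x * i by exists (x + i * x * i).
have bV : b \in V by rewrite bdef memvD ?VM.
have bi : b * i = - (i * b).
  by rewrite bdef mulrDr mulrDl !mulrA ii -(mulrA _ i i) ii mulrN1 mulN1r mulNr opprD opprK addrC.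
have b0 : b != 0.
  apply: contraNneq xs => bE; have ix : i * x = x * i.
    apply: (addIr (i * (i * x * i))); rewrite -mulrDr -bdef bE mulr0.
    by rewrite !mulrA ii mulN1r mulNr subrr.
  have [a [c ->]] := commuting_complex V1 VM VU iV ii xV ix.
  by rewrite memvD ?memvZ ?memv_span // !inE eqxx ?orbT.
have ib2 : i * (b * b) = (b * b) * i.
  by rewrite -mulrA bi mulrN mulrA mulrA -[i * b]opprK -bi !mulNr.
have [a [c bb]] := commuting_complex V1 VM VU iV ii (VM bV bV) ib2.
(* [b] commutes with its square [a + c i] and anticommutes with [i]. *)
have c0 : c = 0.
  have /eqP : c *: (i * b) = 0.
    apply: eq_oppr_eq0; have : b * (b * b) = b * b * b by rewrite mulrA.
    rewrite bb mulrDr mulrDl -!scalerAr -!scalerAl mulr1 mul1r => /addrI {1}<-.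
    by rewrite bi scalerN.
  rewrite scaler_eq0 => /orP[/eqP //|/eqP ib].
  by case/eqP: b0; apply: oppr_inj; rewrite oppr0 -mulN1r -ii -mulrA ib mulr0.
move: bb; rewrite c0 scale0r addr0 => bb.
(* Were [a] the square of a real [s], then [(b - s)(b + s) = 0] would make [b] real, which
   anticommutation with [i] forbids for nonzero [b]. *)
have a0 : a < 0.
  rewrite ltNge; apply/negP => a0; pose s := Num.sqrt a.
  have ss : s * s = a by rewrite -expr2 sqr_sqrtr.
  have F : (b - s%:A) * (b + s%:A) = 0.
    rewrite mulrDr !mulrBl bb -!scalerAl -!scalerAr !mul1r mulr1 scalerA ss.
    by rewrite addrA subrK subrr.
  have bc (r : R) : b = r%:A -> False.
    move=> bE; move: bi; rewrite bE -scalerAl -scalerAr mul1r mulr1 => /eq_oppr_eq0/eqP.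
    rewrite scaler_eq0 => /orP[/eqP r0|/eqP i0]; last first.
      by have /eqP := ii; rewrite i0 mul0r eq_sym oppr_eq0 oner_eq0.
    by move: b0; rewrite bE r0 scale0r eqxx.
  have [z0|z0] := eqVneq (b - s%:A) 0; first exact: (bc s (subr0_eq z0)).
  apply: (bc (- s)); rewrite scaleNr; apply/eqP; rewrite -subr_eq0 opprK; apply/eqP.
  by apply: (mulrI (VU _ z0)); rewrite ?mulr0 // memvB ?memvZ.
have ss : (Num.sqrt (- a))^-1 * (Num.sqrt (- a))^-1 * a = -1.
  have a0' : 0 < - a by rewrite oppr_gt0.
  by rewrite -invfM -expr2 sqr_sqrtr ?ltW // invrN mulNr mulVf ?lt_eqF.
exists i, ((Num.sqrt (- a))^-1 *: b); split; rewrite ?memvZ //; split=> //.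
  by rewrite -scalerAl -scalerAr bb !scalerA ss scaleN1r.
by rewrite -scalerAl -scalerAr bi scalerN.
Qed.

End Frobenius.

Lemma quat_ind (P : quat R -> Prop) : (forall x y, P x -> P y -> P (x + y)) ->
  (forall (a : R) x, P x -> P (a *: x)) -> P 1 -> P (Quat 0 1 0 0) ->
  P (Quat 0 0 1 0) -> P (Quat 0 0 0 1) -> forall q, P q.
Proof.
move=> PD PZ P1 Pi Pj Pk [a b c e].
have -> : Quat a b c e = a *: 1 + b *: Quat 0 1 0 0 + c *: Quat 0 0 1 0 + e *: Quat 0 0 0 1.
  by congr Quat; ring.
by apply: (PD); [apply: (PD); [apply: (PD)|]|]; apply: (PZ).
Qed.

Section Embedding.
Variables i j : A.
Hypothesis ij : quat_pair i j.

Definition quat_emb (q : quat R) : A :=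
  let: Quat a b c e := q in a *: 1 + b *: i + c *: j + e *: (i * j).

Lemma quat_embD x y : quat_emb (x + y) = quat_emb x + quat_emb y.
Proof.
case: x y => a b c e [a' b' c' e'] /=; rewrite !scalerDl.
by rewrite [RHS]addrACA [X in _ = X + _]addrACA [X in _ = X + _ + _]addrACA.
Qed.

Lemma quat_embZ k x : quat_emb (k *: x) = k *: quat_emb x.
Proof. by case: x => a b c e /=; rewrite !scalerDr !scalerA. Qed.

Lemma quat_emb_linear : linear quat_emb.
Proof. by move=> k x y; rewrite quat_embD quat_embZ. Qed.

Lemma quat_emb1 : quat_emb 1 = 1.
Proof. by rewrite /= !scale0r scale1r !addr0. Qed.
Lemma quat_embi : quat_emb (Quat 0 1 0 0) = i.
Proof. by rewrite /= !scale0r scale1r !addr0 add0r. Qed.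
Lemma quat_embj : quat_emb (Quat 0 0 1 0) = j.
Proof. by rewrite /= !scale0r scale1r !addr0 !add0r. Qed.
Lemma quat_embk : quat_emb (Quat 0 0 0 1) = i * j.
Proof. by rewrite /= !scale0r scale1r !add0r. Qed.

Lemma quat_embN x : quat_emb (- x) = - quat_emb x.
Proof. by rewrite -scaleN1r quat_embZ scaleN1r. Qed.

Lemma quat_embM : {morph quat_emb : x y / x * y}.
Proof.
have [ii jj ji] := ij; move=> x y.
have ki : i * j * i = j by rewrite -mulrA ji mulrN mulrA ii mulN1r opprK.
have kj : i * j * j = - i by rewrite -mulrA jj mulrN1.
have ik : i * (i * j) = - j by rewrite mulrA ii mulN1r.
have jk : j * (i * j) = i by rewrite mulrA ji mulNr kj opprK.
have kk : i * j * (i * j) = - 1 by rewrite mulrA ki.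
have qii : Quat 0 1 0 0 * Quat 0 1 0 0 = - 1 :> quat R by congr Quat; ring.
have qij : Quat 0 1 0 0 * Quat 0 0 1 0 = Quat 0 0 0 1 :> quat R by congr Quat; ring.
have qik : Quat 0 1 0 0 * Quat 0 0 0 1 = - Quat 0 0 1 0 :> quat R by congr Quat; ring.
have qji : Quat 0 0 1 0 * Quat 0 1 0 0 = - Quat 0 0 0 1 :> quat R by congr Quat; ring.
have qjj : Quat 0 0 1 0 * Quat 0 0 1 0 = - 1 :> quat R by congr Quat; ring.
have qjk : Quat 0 0 1 0 * Quat 0 0 0 1 = Quat 0 1 0 0 :> quat R by congr Quat; ring.
have qki : Quat 0 0 0 1 * Quat 0 1 0 0 = Quat 0 0 1 0 :> quat R by congr Quat; ring.
have qkj : Quat 0 0 0 1 * Quat 0 0 1 0 = - Quat 0 1 0 0 :> quat R by congr Quat; ring.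
have qkk : Quat 0 0 0 1 * Quat 0 0 0 1 = - 1 :> quat R by congr Quat; ring.
(* By bilinearity only the nine products of [i], [j], [k] remain. *)
elim/quat_ind: x => [x x' Px Px'|k x Px||||].
- by rewrite mulrDl !quat_embD Px Px' mulrDl.
- by rewrite -scalerAl !quat_embZ Px scalerAl.
- by rewrite quat_emb1 !mul1r.
all: elim/quat_ind: y => [y y' Py Py'|k y Py||||];
  [by rewrite mulrDr !quat_embD Py Py' mulrDr|
   by rewrite -scalerAr !quat_embZ Py scalerAr|by rewrite quat_emb1 !mulr1|..].
all: rewrite ?qii ?qij ?qik ?qji ?qjj ?qjk ?qki ?qkj ?qkk ?quat_embN.
all: rewrite ?quat_embi ?quat_embj ?quat_embk ?quat_emb1 // ?ik ?jk ?ki ?kj ?kk //.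
Qed.

End Embedding.
End Quaternions.

(** * Components of dimension 1 and 4 *)

Section OneDimensional.
Variables (R : realType) (G : abelGroupType) (D : falgType R).
Variable Gm : divGrading G D.
Hypothesis dim1 : components_dim Gm 1.
Local Notation T := (suppg Gm).
Local Notation Stab := (stabg Gm).

Let y (t : T) : D := vpick (Gm (val t)).

Let yG t : y t \in Gm (val t). Proof. exact: memv_pick. Qed.
Let y0 t : y t != 0. Proof. by rewrite vpick0; exact: (valP t). Qed.

Lemma line_comp (t : T) x : x \in Gm (val t) -> exists r : R, x = r *: y t.
Proof.
move=> xt; apply/vlineP; suff -> : <[y t]>%VS = Gm (val t) by [].
apply/eqP; rewrite eqEdim -memvE yG /= dim_vline y0.
by rewrite (dim_comp dim1).
Qed.

Let yM s t : exists r : R, y s * y t = r *: y (s * t)%g.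
Proof. exact/line_comp/homogM. Qed.

Lemma line_char : exists2 P : Stab -> homg T pm1, {morph P : f g / (f * g)%g} &
  forall (f : Stab) t, f (y t) = pmr R (P f t) *: y t.
Proof.
apply: (eigen_hom (y := y)) => // f t.
exact/line_comp/stab_homog.
Qed.

Let Psi_triv (P : Stab -> homg T pm1) (f : Stab) :
  (forall (f : Stab) t, f (y t) = pmr R (P f t) *: y t) -> P f = 1%g -> f = 1%g.
Proof.
move=> PE P1; apply: stab_eq => t x /line_comp[r ->].
by rewrite !linearZ /= PE P1 scale1r id_lfunE.
Qed.

Lemma line_stab_iso : group_iso Stab (homg T pm1).
Proof.
have [P PM PE] := line_char; apply: (group_isoP PM).
  by apply: (morph_inj PM) => f; apply: Psi_triv.
move=> k; have [f fE] := stab_of_char k; exists f.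
by apply: (eigen_char_inj (y := y)) => // t; rewrite -PE (fE t).
Qed.

Let Psi_inner (P : Stab -> homg T pm1) t (f : Stab) :
  (forall (f : Stab) t, f (y t) = pmr R (P f t) *: y t) ->
  (forall x, f x = y t * x * (y t)^-1) -> P f = 1%g -> forall x, y t * x = x * y t.
Proof.
move=> PE fE /(Psi_triv PE) f1 x; have := fE x; rewrite f1 id_lfunE => {2}->.
by rewrite mulrVK // (hcomp_unit (yG t)).
Qed.

Lemma line_elementary : (\dim 'Z({:D}) <= 1)%N -> forall t : T, (t * t = 1)%g.
Proof.
have [P PM PE] := line_char.
by apply: (supp_elementary dim1 yG y0 yM PM) => t f; apply: Psi_inner.
Qed.

Lemma line_all_inner : (\dim 'Z({:D}) <= 2)%N ->
  ~ (forall t : T, (t * t = 1)%g) -> forall f : Stab, inner_aut (val f).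
Proof.
have [P PM PE] := line_char.
apply: (all_inner_of_center dim1 yG y0 yM PM) => [t f|f /(Psi_triv PE)->].
  exact: Psi_inner.
by exists 1 => [|x]; rewrite ?unitr1 // id_lfunE mul1r invr1 mulr1.
Qed.

End OneDimensional.

(** * Components of dimension 4: the identity component is the quaternions *)

Section FourDimensional.
Variables (R : realType) (G : abelGroupType) (D : falgType R).
Variable Gm : divGrading G D.
Hypothesis dim4 : components_dim Gm 4.
Local Notation T := (suppg Gm).
Local Notation Stab := (stabg Gm).

Let De1 : 1 \in Gm 1%g. Proof. exact: homog1 dim4. Qed.
Let DeM : {in Gm 1%g &, forall x y, x * y \in Gm 1%g}.
Proof. by move=> x y x1 y1; rewrite -[1%g]mulg1 homogM. Qed.
Let DeU : {in Gm 1%g, forall x, x != 0 -> x \is a GRing.unit}.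
Proof. by move=> x; apply: hcomp_unit. Qed.
Let De_dim : \dim (Gm 1%g) = 4. Proof. exact: (dim_comp dim4 1%g). Qed.

Lemma identity_quat_pair : exists ij : D * D,
  [/\ ij.1 \in Gm 1%g, ij.2 \in Gm 1%g & quat_pair ij.1 ij.2].
Proof.
have [|i [j H]] := exists_quat_pair De1 DeM DeU; first by rewrite De_dim.
by exists (i, j).
Qed.

Variables i j : D.
Hypotheses (iD : i \in Gm 1%g) (jD : j \in Gm 1%g) (ij : quat_pair i j).
Local Notation rho := (quat_emb i j).

Let rho_mem q : rho q \in Gm 1%g.
Proof. by case: q => a b c e /=; rewrite !memvD ?memvZ ?DeM. Qed.

(** A quaternion times its conjugate is a sum of four squares. *)
Lemma quat_emb_inj : injective rho.
Proof.
suff K q : rho q = 0 -> q = 0.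
  move=> p q pq; apply/subr0_eq/K.
  by rewrite quat_embD quat_embN pq subrr.
case: q => a b c e q0; pose n := a ^+ 2 + b ^+ 2 + c ^+ 2 + e ^+ 2.
have : rho (Quat a b c e * Quat a (- b) (- c) (- e)) = 0.
  by rewrite quat_embM // q0 mul0r.
have -> : Quat a b c e * Quat a (- b) (- c) (- e) = n *: 1 :> quat R.
  by rewrite /n; congr Quat; ring.
rewrite quat_embZ quat_emb1 => /eqP; rewrite scaler_eq0 oner_eq0 orbF /n.
rewrite !paddr_eq0 ?addr_ge0 ?sqr_ge0 // !sqrf_eq0.
by case/andP => /andP[/andP[/eqP-> /eqP->] /eqP->] /eqP->.
Qed.

Lemma quat_emb_onto x : x \in Gm 1%g -> exists q, rho q = x.
Proof.
pose f : {linear quat R -> D} :=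
  HB.pack rho (GRing.isLinear.Build R (quat R) D _ rho (@quat_emb_linear _ _ i j)).
have E q : linfun f q = rho q by rewrite lfunE.
suff <- : limg (linfun f) = Gm 1%g by case/memv_imgP=> q _ ->; exists q; rewrite E.
apply/eqP; rewrite eqEdim; apply/andP; split.
  by apply/subvP => _ /memv_imgP[q _ ->]; rewrite E.
rewrite De_dim limg_dim_eq ?dimvf //; apply/eqP; rewrite capfv; apply/lker0P => p q.
by rewrite !E => /quat_emb_inj.
Qed.

Lemma De_ind (P : D -> Prop) : (forall x y, P x -> P y -> P (x + y)) ->
  (forall (a : R) x, P x -> P (a *: x)) -> P 1 -> P i -> P j -> P (i * j) ->
  {in Gm 1%g, forall x, P x}.
Proof.
move=> PD PZ P1 Pi Pj Pk x /quat_emb_onto[q <-].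
elim/quat_ind: q => [p q|a q||||].
- by rewrite quat_embD; apply: PD.
- by rewrite quat_embZ; apply: PZ.
- by rewrite quat_emb1.
- by rewrite quat_embi.
- by rewrite quat_embj.
- by rewrite quat_embk.
Qed.

Let commute_De u : i * u = u * i -> j * u = u * j -> {in Gm 1%g, forall x, x * u = u * x}.
Proof.
move=> iu ju; apply: De_ind => [x z Px Pz|a x Px||||] //.
- by rewrite mulrDl mulrDr Px Pz.
- by rewrite -scalerAl Px scalerAr.
- by rewrite mul1r mulr1.
- by rewrite -mulrA ju mulrA iu mulrA.
Qed.

(** [quat_intertwiner] with the same pair on both sides gives an element of [D_t] commuting with [i]
    and [j], which generate [D_e]. *)
Lemma exists_commuting (t : T) :
  exists2 u, u \in Gm (val t) /\ u != 0 & {in Gm 1%g, forall x, x * u = u * x}.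
Proof.
have x0 : vpick (Gm (val t)) != 0 by rewrite vpick0; exact: (valP t).
have L (z : D) : z \in Gm 1%g -> {in Gm (val t), forall x, z * x \in Gm (val t)}.
  by move=> z1 x xt; rewrite -[val t]mul1g homogM.
have L' (z : D) : z \in Gm 1%g -> {in Gm (val t), forall x, x * z \in Gm (val t)}.
  by move=> z1 x xt; rewrite -[val t]mulg1 homogM.
have [u uP [iu ju]] := quat_intertwiner ij ij (L i iD) (L j jD) (L' i iD) (L' j jD)
  (memv_pick _) x0.
by exists u => //; apply: commute_De.
Qed.

Lemma central_De x : x \in Gm 1%g -> i * x = x * i -> j * x = x * j ->
  exists r : R, x = r%:A.
Proof.
have [ii jj ji] := ij; move=> x1 ix jx.
have [a [b xE]] := commuting_complex De1 DeM DeU iD ii x1 ix.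
suff b0 : b = 0 by exists a; rewrite xE b0 scale0r addr0.
have /eqP : b *: (i * j) = 0.
  apply: eq_oppr_eq0; move: jx.
  by rewrite xE mulrDr mulrDl -!scalerAl -!scalerAr mul1r mulr1 ji scalerN => /addrI ->.
rewrite scaler_eq0 => /orP[/eqP //|/eqP k0].
have /eqP : i * j * j = 0 by rewrite k0 mul0r.
rewrite -mulrA jj mulrN1 oppr_eq0 => /eqP i0.
by have /eqP := ii; rewrite i0 mul0r eq_sym oppr_eq0 oner_eq0.
Qed.

Variable y : T -> D.
Hypotheses (yG : forall t, y t \in Gm (val t)) (y0 : forall t, y t != 0).
Hypothesis yC : forall t, {in Gm 1%g, forall x, x * y t = y t * x}.

Let yU t : y t \is a GRing.unit. Proof. exact: hcomp_unit (yG t) (y0 t). Qed.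

(** [x] is [e * y t] with [e] in the center of [D_e], which is real. *)
Lemma commuting_line (t : T) x : x \in Gm (val t) ->
  {in Gm 1%g, forall z, z * x = x * z} -> exists r : R, x = r *: y t.
Proof.
move=> xt xC; have [e e1 xE] := homog_div dim4 (yG t) (y0 t) xt.
have eC z : z \in Gm 1%g -> z * e = e * z.
  move=> z1; apply: (mulIr (yU t)); rewrite -mulrA -xE xC // xE -!mulrA.
  by rewrite yC.
have [r rE] := central_De e1 (eC i iD) (eC j jD).
by exists r; rewrite xE rE mulr_algl.
Qed.

Let yM s t : exists r : R, y s * y t = r *: y (s * t)%g.
Proof.
apply: commuting_line; first exact: homogM.
by move=> z z1; rewrite mulrA (yC s z1) -mulrA (yC t z1) mulrA.
Qed.

Lemma stab_De_onto (f : Stab) x : x \in Gm 1%g -> exists2 x', x' \in Gm 1%g & x = f x'.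
Proof.
have /asboolP/(_ 1%g) := valP f.
by move=> {1}<- /memv_imgP[x' x1 ->]; exists x'.
Qed.

(** [f] maps [D_e] onto itself, so [f (y t)] again commutes with [D_e]. *)
Lemma quat_char : exists2 P : Stab -> homg T pm1, {morph P : f g / (f * g)%g} &
  forall (f : Stab) t, f (y t) = pmr R (P f t) *: y t.
Proof.
apply: (eigen_hom (y := y)) => // f t; apply: commuting_line; first exact: stab_homog.
by move=> z /(stab_De_onto f)[z' z1 ->]; rewrite -!stab_rmorphM yC.
Qed.

Lemma stab_eq_gens (f h : Stab) : {in Gm 1%g, f =1 h} -> (forall t, f (y t) = h (y t)) ->
  f = h.
Proof.
move=> fh fy; apply: stab_eq => t x /(homog_div dim4 (yG t) (y0 t))[e e1 ->].
by rewrite !stab_rmorphM fh ?fy.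
Qed.

Lemma inner_De u : u \in Gm 1%g -> u != 0 -> exists2 f : Stab,
  forall x, f x = u * x * u^-1 & forall t, f (y t) = y t.
Proof.
move=> u1 u0; have [f fE] := stab_inner dim4 (t := 1%g) u1 u0; exists f => // t.
by rewrite fE yC // mulrK // DeU.
Qed.

(** Skolem-Noether for the quaternions: [quat_intertwiner] is applied in [D_e] to [i, j] and their
    images under [h]. The resulting [u] lies in [D_e], so conjugation by it fixes each [y t]. *)
Lemma quat_aut_inner (h : algAut (quat R)) : exists2 f : Stab,
  forall q, f (rho q) = rho (h q) & inner_aut (val f) /\ forall t, f (y t) = y t.
Proof.
have hM p q : rho (h p) * rho (h q) = rho (h (p * q)) by rewrite rmorphM /= quat_embM.
have ij' : quat_pair (rho (h (Quat 0 1 0 0))) (rho (h (Quat 0 0 1 0))).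
  have [ii jj ji] := ij; have [e1 e2] := (quat_embi i j, quat_embj i j).
  have E p : p = -1 -> rho (h p) = -1.
    by move=> ->; rewrite rmorphN rmorph1 quat_embN quat_emb1.
  split; rewrite !hM.
  - by apply: E; apply: quat_emb_inj; rewrite quat_embM // e1 ii quat_embN quat_emb1.
  - by apply: E; apply: quat_emb_inj; rewrite quat_embM // e2 jj quat_embN quat_emb1.
  - rewrite -quat_embN -rmorphN /=; congr (rho (h _)); apply: quat_emb_inj.
    by rewrite quat_embN !quat_embM // e1 e2.
have C z : z \in Gm 1%g -> {in Gm 1%g, forall x, z * x \in Gm 1%g} by move=> z1 x x1; apply: DeM.
have C' z : z \in Gm 1%g -> {in Gm 1%g, forall x, x * z \in Gm 1%g} by move=> z1 x x1; apply: DeM.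
have [u [u1 u0] [iu ju]] := quat_intertwiner ij ij' (C _ (rho_mem _)) (C _ (rho_mem _))
  (C' _ iD) (C' _ jD) De1 (oner_neq0 D).
have [f fE fy] := inner_De u1 u0; exists f; last first.
  by split=> //; exists u => //; apply: DeU.
suff hu q : rho (h q) * u = u * rho q by move=> q; rewrite fE -hu mulrK ?DeU.
elim/quat_ind: q => [p q Pp Pq|a q Pq||||].
- by rewrite linearD !quat_embD mulrDl Pp Pq mulrDr.
- by rewrite linearZ !quat_embZ -scalerAl Pq scalerAr.
- by rewrite rmorph1 quat_emb1 mul1r mulr1.
- by rewrite iu quat_embi.
- by rewrite ju quat_embj.
- have -> : Quat 0 0 0 1 = Quat 0 1 0 0 * Quat 0 0 1 0 :> quat R by congr Quat; ring.
  by rewrite -hM -mulrA ju mulrA iu -mulrA quat_embM // quat_embi quat_embj.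
Qed.

Lemma stab_quat_aut (f : Stab) : exists h : algAut (quat R), forall q, rho (h q) = f (rho q).
Proof.
have /choice[g gE] q : exists p, rho p = f (rho q).
  exact/quat_emb_onto/stab_homog.
have [||||h hE] := @algAut_of_fun _ (quat R) g.
- by move=> a p q; apply: quat_emb_inj; rewrite quat_emb_linear !gE quat_emb_linear linearP.
- by move=> p q; apply: quat_emb_inj; rewrite quat_embM // !gE quat_embM // stab_rmorphM.
- by apply: quat_emb_inj; rewrite gE quat_emb1 stab_rmorph1.
- by move=> p q gpq; apply/quat_emb_inj/(@stab_inj _ _ _ _ f); rewrite -!gE gpq.
by exists h => q; rewrite hE gE.
Qed.

Let Psi_inner (P : Stab -> homg T pm1) t (f : Stab) :
  (forall (f : Stab) t, f (y t) = pmr R (P f t) *: y t) ->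
  (forall x, f x = y t * x * (y t)^-1) -> P f = 1%g -> forall x, y t * x = x * y t.
Proof.
move=> PE fE f1 x; suff f_id : f = 1%g.
  have := fE x; rewrite f_id id_lfunE => {2}->.
  by rewrite mulrVK.
apply: stab_eq_gens => [z z1|s]; last by rewrite PE f1 scale1r id_lfunE.
by rewrite fE -yC // mulrK // id_lfunE.
Qed.

Lemma quat_elementary : (\dim 'Z({:D}) <= 1)%N -> forall t : T, (t * t = 1)%g.
Proof.
have [P PM PE] := quat_char.
by apply: (supp_elementary dim4 yG y0 yM PM) => t f; apply: Psi_inner.
Qed.

Lemma quat_all_inner : (\dim 'Z({:D}) <= 2)%N ->
  ~ (forall t : T, (t * t = 1)%g) -> forall f : Stab, inner_aut (val f).
Proof.
have [P PM PE] := quat_char.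
apply: (all_inner_of_center dim4 yG y0 yM PM) => [t f|f f1]; first exact: Psi_inner.
have [h hE] := stab_quat_aut f; have [g gE [gi gy]] := quat_aut_inner h.
suff -> : f = g by [].
apply: stab_eq_gens => [z /quat_emb_onto[q <-]|t]; first by rewrite gE hE.
by rewrite PE f1 scale1r gy.
Qed.

Lemma quat_stab_iso : group_iso Stab (algAut (quat R) * homg T pm1)%type.
Proof.
have [P PM PE] := quat_char; have [Q QE] := choice stab_quat_aut.
have QM : {morph Q : f g / (f * g)%g}.
  move=> f g; apply: algAutP => q; apply: quat_emb_inj.
  by rewrite QE stabM algAutM !QE.
apply: (@group_isoP _ _ (fun f => (Q f, P f) : (algAut (quat R) * homg T pm1)%type)).
- by move=> f g; rewrite QM PM.
- apply: morph_inj => [f g|f [Qf Pf]]; first by rewrite QM PM.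
  apply: stab_eq_gens => [x /quat_emb_onto[q <-]|t]; last by rewrite PE Pf scale1r id_lfunE.
  by rewrite -QE Qf !id_lfunE.
(* The two factors are realized independently: [g] fixes each [y t], and [f] is the identity on
   [D_e] because [k 1] is 1. *)
case=> h k; have [g gE [_ gy]] := quat_aut_inner h; have [f fE] := stab_of_char k.
have kf1 x : x \in Gm 1%g -> f x = x.
  by move=> x1; rewrite (fE 1%g) // (morph_mul1 (homgM k)) scale1r.
exists (g * f)%g; congr pair.
  apply: algAutP => q; apply: quat_emb_inj.
  by rewrite QE stabM kf1 ?gE.
apply: (eigen_char_inj (y := y)) => // t.
by rewrite -PE stabM (fE t) // linearZ /= gy.
Qed.

End FourDimensional.

(** * Components of dimension 2 *)

Section Phase.
Variable R : realType.
Implicit Types z w : units R[i].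

(** Identifies the classes modulo real units with the complex numbers of modulus 1. *)
Definition phase z : R[i] := val z / conjc (val z).

Lemma units_neq0 z : val z != 0.
Proof. by rewrite -unitfE; exact: (valP z). Qed.
Lemma conjc_neq0 z : conjc (val z) != 0.
Proof. by rewrite fmorph_eq0 units_neq0. Qed.

Lemma phaseM z w : phase (z * w)%g = phase z * phase w.
Proof. by rewrite /phase unitsM rmorphM /= invfM mulrACA. Qed.
Lemma phaseV z : phase (z^-1)%g = conjc (phase z).
Proof. by rewrite /phase /= rmorphM !fmorphV /= conjcK invrK mulrC. Qed.

Lemma conjc_fixed (z : R[i]) : (conjc z == z) = (complex.Im z == 0).
Proof.
case: z => a b; rewrite eq_complex /= eqxx /= eq_sym -subr_eq0 opprK -mulr2n.
by rewrite mulrn_eq0.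
Qed.

Lemma phase_classP z w : CxRx_class z = CxRx_class w <-> phase z = phase w.
Proof.
rewrite /CxRx_class /cosetg; split.
  move/pi_eqP; rewrite inE -conjc_fixed /= rmorphM fmorphV /= => /eqP zw.
  rewrite /phase; apply/eqP; rewrite eqr_div ?conjc_neq0 //; apply/eqP.
  have /= := congr1 (fun x => x * val w * conjc (val w)) zw.
  rewrite mulrAC divfK ?conjc_neq0 // divfK ?units_neq0 // => <-.
  by rewrite mulrC.
rewrite /phase => /eqP; rewrite eqr_div ?conjc_neq0 // => /eqP zw.
apply/pi_eqP; rewrite inE -conjc_fixed /= rmorphM fmorphV /=.
by rewrite eqr_div ?conjc_neq0 ?units_neq0 // zw mulrC.
Qed.

Lemma CxRx_classM z w : CxRx_class (z * w)%g = (CxRx_class z * CxRx_class w)%g.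
Proof. by rewrite /CxRx_class /cosetg -quotg_mulE. Qed.
Lemma CxRx_classV z : CxRx_class (z^-1)%g = (CxRx_class z)^-1%g.
Proof. by rewrite /CxRx_class /cosetg -quotg_invE. Qed.
Lemma CxRx_class_onto x : exists z, CxRx_class z = x.
Proof. by exists (repr x); apply: reprK. Qed.

(** [z] times its conjugate is real, so conjugation acts on the quotient as inversion. *)
Lemma CxRx_conj z : CxRx_class (conj_units z) = (CxRx_class z)^-1%g.
Proof.
rewrite -CxRx_classV; apply/phase_classP.
by rewrite phaseV /phase /= conjcK rmorphM fmorphV /= conjcK.
Qed.

Lemma phase1 : phase 1%g = 1.
Proof. by rewrite /phase (_ : val (1%g : units R[i]) = 1) // rmorph1 divr1. Qed.

(* Hilbert 90 for [C / R]. *)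
Lemma phase_onto (u : R[i]) : u * conjc u = 1 -> exists z, phase z = u.
Proof.
(* [z = 1 + u] works unless it is 0, and for [u = -1] one takes the imaginary unit. *)
move=> uu; have [u1|u1] := eqVneq (1 + u) 0.
  have iU : ('i%C : R[i]) \is a GRing.unit by rewrite unitfE eq_complex /= oner_eq0 andbF.
  exists (Units iU).
  have -> : u = -1 by apply/eqP; rewrite -addr_eq0 addrC u1.
  rewrite /phase; have -> : conjc (val (Units iU)) = - val (Units iU).
    by apply/eqP; rewrite eq_complex /= oppr0 !eqxx.
  by rewrite invrN mulrN divff ?units_neq0.
have U : 1 + u \is a GRing.unit by rewrite unitfE.
exists (Units U); rewrite /phase /=; apply: (mulIf (_ : conjc (1 + u) != 0)).
  by rewrite fmorph_eq0.
by rewrite divfK ?fmorph_eq0 // rmorphD rmorph1 mulrDr uu mulr1 addrC.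
Qed.

End Phase.

(** * The identity component as the complex numbers, and the character with kernel [K] *)

Section TwoDimensional.
Variables (R : realType) (G : abelGroupType) (D : falgType R).
Variable Gm : divGrading G D.
Hypothesis dim2 : components_dim Gm 2.
Local Notation T := (suppg Gm).
Local Notation Stab := (stabg Gm).

Let De1 : 1 \in Gm 1%g. Proof. exact: homog1 dim2. Qed.
Let DeM : {in Gm 1%g &, forall x y, x * y \in Gm 1%g}.
Proof. by move=> x y x1 y1; rewrite -[1%g]mulg1 homogM. Qed.
Let DeU : {in Gm 1%g, forall x, x != 0 -> x \is a GRing.unit}.
Proof. by move=> x; apply: hcomp_unit. Qed.
Let De_dim : \dim (Gm 1%g) = 2. Proof. exact: (dim_comp dim2 1%g). Qed.

Lemma identity_imaginary_unit : exists2 i, i \in Gm 1%g & i * i = - 1.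
Proof. by apply: (exists_imaginary_unit De1 DeM DeU); rewrite De_dim. Qed.

Variable i : D.
Hypotheses (iD : i \in Gm 1%g) (ii : i * i = - 1).

Definition cx_emb (z : R[i]) : D := complex.Re z *: 1 + complex.Im z *: i.
Local Notation cx := cx_emb.

Lemma cx_mem z : cx z \in Gm 1%g. Proof. by rewrite memvD ?memvZ. Qed.

Lemma cxM z w : cx (z * w) = cx z * cx w.
Proof.
case: z w => a b [c e]; rewrite /cx_emb /= mulrDl !mulrDr -!scalerAl -!scalerAr.
rewrite !mul1r mulr1 ii !scalerA scalerN [X in _ = _ + _ + X]addrC [RHS]addrACA.
by rewrite -scalerBl -scalerDl.
Qed.

Lemma cx_real (r : R) : cx (r +i* 0)%C = r%:A.
Proof. by rewrite /cx_emb /= scale0r addr0. Qed.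
Lemma cx1 : cx 1 = 1. Proof. by rewrite /cx_emb /= scale1r scale0r addr0. Qed.
Lemma cxi : cx 'i%C = i. Proof. by rewrite /cx_emb /= scale1r scale0r add0r. Qed.

Let i_neq0 : i != 0.
Proof. by apply: contra_eq_neq ii => ->; rewrite mul0r eq_sym oppr_eq0 oner_eq0. Qed.

Let i_free : free [:: 1; i].
Proof.
rewrite free_cons seq1_free i_neq0 andbT span_seq1; apply/negP => /vlineP[r r1].
have : (1 + r * r) *: (1 : D) = 0.
  have := congr1 (fun x => x * x) r1.
  by rewrite mulr1 -scalerAl -scalerAr ii scalerA scalerN scalerDl scale1r => {1}->; rewrite addNr.
move/eqP; rewrite scaler_eq0 oner_eq0 orbF => /eqP r0.
by have := sqr_ge0 r; rewrite expr2; lra.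
Qed.

Lemma cx_onto x : x \in Gm 1%g -> exists z, x = cx z.
Proof.
have <- : <<[:: 1%R; i]>>%VS = Gm 1%g.
  apply/eqP; rewrite eqEdim De_dim (eqP i_free) andbT.
  by apply/span_subvP => z; rewrite !inE => /orP[]/eqP->.
rewrite span_cons span_seq1 => /memv_addP[_ /vlineP[a ->] [_ /vlineP[b ->] ->]].
by exists (a +i* b)%C.
Qed.

Lemma cx_eq0 z : cx z = 0 -> z = 0.
Proof.
have F := elimT (@freeP _ _ 2 [tuple 1; i]) i_free; case: z => a b z0.
have := F (fun k => if k == ord0 then a else b); rewrite big_ord_recl big_ord1 /=.
move=> /(_ z0) H; have := H ord0; have := H (lift ord0 ord0); rewrite /= => -> ->.
by [].
Qed.

Lemma cxD z w : cx (z + w) = cx z + cx w.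
Proof. by case: z w => a b [c e]; rewrite /cx_emb /= !scalerDl addrACA. Qed.

Lemma cxN z : cx (- z) = - cx z.
Proof. by case: z => a b; rewrite /cx_emb /= !scaleNr opprD. Qed.

Lemma cx_inj : injective cx.
Proof. by move=> z w zw; apply/subr0_eq/cx_eq0; rewrite cxD cxN zw subrr. Qed.

Lemma cx_neq0 z : z != 0 -> cx z != 0.
Proof. by apply: contra_neq => /cx_eq0. Qed.

Lemma cx_unit (z : units R[i]) : cx (val z) \is a GRing.unit.
Proof. by apply: DeU (cx_mem _) (cx_neq0 (units_neq0 z)). Qed.

Local Notation K := (cent_supp Gm).

(** [D_t] is [D_e] times one nonzero element of the centralizer, and [D_e] is commutative. *)
Lemma cent_suppP (t : T) : val t \in K -> forall x, x \in Gm (val t) ->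
  forall z, x * cx z = cx z * x.
Proof.
rewrite inE => tK x xt z; have u0 : vpick ('C(Gm 1%g) :&: Gm (val t))%VS != 0 by rewrite vpick0.
have /memv_capP[/centvP uC ut] := memv_pick ('C(Gm 1%g) :&: Gm (val t))%VS.
have [_ /cx_onto[w ->] ->] := homog_div dim2 ut u0 xt.
by rewrite -mulrA uC ?cx_mem // !mulrA -!cxM mulrC.
Qed.

(** [x - i x i] commutes with [i], so it lies in the centralizer and vanishes in degrees outside
    [K]; hence [i x = - x i]. *)
Lemma cent_suppN (t : T) : val t \notin K -> forall x, x \in Gm (val t) ->
  forall z, x * cx z = cx (conjc z) * x.
Proof.
rewrite inE negbK => /eqP tK x xt.
have : x - i * x * i \in 'C(Gm 1%g)%VS.
  have : (x - i * x * i) * i = i * (x - i * x * i).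
    by rewrite mulrBr mulrBl !mulrA ii mulN1r mulNr opprK -(mulrA _ i i) ii mulrN1 opprK addrC.
  move: (x - _) => w wi; apply/centvP => _ /cx_onto[[a b] ->].
  by rewrite /cx_emb /= mulrDl mulrDr -!scalerAl -!scalerAr mul1r mulr1 wi.
move=> xC; have : x - i * x * i \in ('C(Gm 1%g) :&: Gm (val t))%VS.
  rewrite memv_cap xC memvB // -[val t]mulg1 -[(_ * 1)%g]mul1g mulgA.
  by rewrite !homogM.
rewrite tK memv0 => /eqP/subr0_eq xE.
have xi : i * x = - (x * i) by rewrite {1}xE !mulrA ii mulN1r mulNr.
case=> a b; rewrite /cx_emb /= mulrDl mulrDr -!scalerAl -!scalerAr mul1r mulr1 xi.
by rewrite scalerN scaleNr opprK.
Qed.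

Definition cj (t : T) (z : R[i]) := if val t \in K then z else conjc z.

Lemma homog_cx (t : T) x z : x \in Gm (val t) -> x * cx z = cx (cj t z) * x.
Proof.
by move=> xt; rewrite /cj; case: ifPn => tK; [exact: (cent_suppP tK xt z)|exact: (cent_suppN tK xt z)].
Qed.

Definition kappa_fun (t : T) : pm1 := pmb (val t \notin K).

Lemma kappa_i (t : T) x : x \in Gm (val t) -> x * i = pmr R (kappa_fun t) *: (i * x).
Proof.
move=> xt; rewrite -cxi (homog_cx _ xt) /cj /kappa_fun; case: ifP => _ /=.
  by rewrite scale1r.
by rewrite /cx_emb /= !scale0r !add0r scaleN1r scale1r mulNr scaleN1r.
Qed.

(** Moving [i] past a product of two nonzero homogeneous elements collects both signs. *)
Lemma kappaM : {morph kappa_fun : s t / (s * t)%g}.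
Proof.
move=> s t; have s0 : vpick (Gm (val s)) != 0 by rewrite vpick0; exact: (valP s).
have t0 : vpick (Gm (val t)) != 0 by rewrite vpick0; exact: (valP t).
have [sG tG] := (memv_pick (Gm (val s)), memv_pick (Gm (val t))).
move: (vpick (Gm (val s))) (vpick (Gm (val t))) sG tG s0 t0 => x y xs yt x0 y0.
have := kappa_i (t := (s * t)%g) (homogM xs yt); rewrite -mulrA (kappa_i yt) -scalerAr mulrA.
rewrite (kappa_i xs) -scalerAl scalerA -pmrM mulgC -mulrA => /eqP.
rewrite -subr_eq0 -scalerBl scaler_eq0 => /orP[|/eqP].
  by rewrite subr_eq0 => /eqP/(@pmr_inj R).
have U := hcomp_unit xs x0; have U' := hcomp_unit yt y0.
move/(congr1 (fun z => z * y^-1 * x^-1)); rewrite /= !mulrA mulrK // mulrK // !mul0r.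
by move/eqP; rewrite (negPf i_neq0).
Qed.

Lemma kappa_subproof : `[< {morph kappa_fun : s t / (s * t)%g} >].
Proof. exact/asboolP/kappaM. Qed.
Definition kappa : homg T pm1 := Homg kappa_subproof.

Lemma kappa1 (t : T) : val t \in K -> kappa t = 1%g.
Proof. by rewrite /= /kappa_fun => ->. Qed.
Lemma kappaN1 (t : T) : val t \notin K -> kappa t = pmb true.
Proof. by rewrite /= /kappa_fun => ->. Qed.

(** If [K] were the whole support, [D_e] would be central, and by dimension equal to the center. *)
Lemma exists_notin_K : (\dim 'Z({:D}) <= 2)%N -> Gm 1%g <> 'Z({:D})%VS ->
  exists t : T, val t \notin K.
Proof.
move=> Z2 nZ; apply: contrapT => no; apply: nZ; apply/eqP; rewrite eqEdim De_dim Z2 andbT.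
apply/subvP => _ /cx_onto[z ->]; rewrite memv_cap memvf; apply/centvP => x _; apply: esym.
move: x; apply: (homog_ind (Gm := Gm)) => [|x y Px Py|t x xt].
- by rewrite mul0r mulr0.
- by rewrite [LHS]mulrDl [RHS]mulrDr Px Py.
apply: (@cent_suppP t _ x xt z); apply: contrapT => tK; apply: no; exists t; exact/negP.
Qed.

End TwoDimensional.

(** * The real form attached to a fixed [x0] in a degree outside [K] *)

Section Anticommuting.
Variables (R : realType) (G : abelGroupType) (D : falgType R).
Variable Gm : divGrading G D.
Hypothesis dim2 : components_dim Gm 2.
Local Notation T := (suppg Gm).
Local Notation Stab := (stabg Gm).
Local Notation K := (cent_supp Gm).
Variable i : D.
Hypotheses (iD : i \in Gm 1%g) (ii : i * i = - 1).
Local Notation cx := (cx_emb i).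
Local Notation kappa := (kappa dim2 iD ii).
Let cxM := cxM ii.
Let cx_mem := cx_mem dim2 iD.
Let cx_onto := cx_onto dim2 iD ii.
Let cx_inj := @cx_inj _ _ _ ii.
Let homog_cx := @homog_cx _ _ _ _ dim2 _ iD ii.
Variables (t0 : T) (x0 : D).
Hypotheses (t0K : val t0 \notin K) (x0G : x0 \in Gm (val t0)) (x0_neq0 : x0 != 0).

Let x0U : x0 \is a GRing.unit. Proof. exact: hcomp_unit x0G x0_neq0. Qed.

Lemma x0_cx z : x0 * cx z = cx (conjc z) * x0.
Proof. by rewrite (homog_cx _ x0G) /cj (negPf t0K). Qed.

Lemma normc_real (z : R[i]) : exists2 r : R, 0 <= r & conjc z * z = (r +i* 0)%C.
Proof.
case: z => a b; exists (a ^+ 2 + b ^+ 2); first by rewrite addr_ge0 ?sqr_ge0.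
by apply/eqP; rewrite eq_complex /=; apply/andP; split; apply/eqP; ring.
Qed.

(** Some positive power of [x0 * x0] has degree 1, so it lies in [D_e]. It commutes with [x0], which
    acts on [D_e] by conjugation, so it is real. *)
Lemma x0_sq_pow : exists n (s : R), s != 0 /\ (x0 * x0) ^+ n.+1 = s%:A.
Proof.
have [l [_ lP _]] := supp_enum Gm; have [n tn] := finite_order (t0 * t0)%g lP.
have aG m : (x0 * x0) ^+ m \in Gm (val ((t0 * t0) ^+ m)%g).
  elim: m => [|m IH]; first by rewrite expr0; exact: homog1 dim2.
  by rewrite exprS expgS; apply: homogM IH; apply: homogM.
have := aG n.+1; rewrite tn => /cx_onto[z zE].
have : x0 * cx z = cx z * x0 by rewrite -zE; apply: commrX; rewrite /GRing.comm mulrA.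
rewrite x0_cx => /(mulIr x0U)/cx_inj/eqP; rewrite conjc_fixed.
case: z zE => a b zE /= /eqP b0; move: zE; rewrite b0 cx_real => zE.
exists n, a; split=> //; apply: contraTneq (unitrX n.+1 x0U) => a0.
have : (x0 * x0) ^+ n.+1 \is a GRing.unit by rewrite unitrX // unitrMl.
by rewrite zE a0 scale0r unitr0.
Qed.

Lemma nonneg_root1 (r : R) n : 0 <= r -> r ^+ n.+1 = 1 -> r = 1.
Proof. by move=> r0 /eqP; rewrite pexpr_eq1 // => /eqP. Qed.

(** Write [x0 x = m x x0] with [m] in [D_e]. Moving [x0] past [x] twice produces the real factor
    [r = |m|^2]. As some power of [x0 * x0] is a nonzero real, a power of [r] is 1, hence so is
    [r]. *)
Lemma x0_sq_central (t : T) x : x \in Gm (val t) -> x0 * x0 * x = x * (x0 * x0).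
Proof.
move=> xt; have [->|xn0] := eqVneq x 0; first by rewrite mulr0 mul0r.
have xU := hcomp_unit xt xn0.
have yG : x * x0 \in Gm (val (t0 * t)%g) by rewrite mulgC; apply: homogM.
have y0 : x * x0 != 0 by apply: contraTneq x0U => y0; rewrite -(unitrMr _ xU) y0 unitr0.
have [_ /cx_onto[m ->] xm] := homog_div dim2 yG y0 (homogM x0G xt : _ \in Gm (val (t0 * t)%g)).
have [r r0 rE] := normc_real m.
have ax : x0 * x0 * x = r *: (x * (x0 * x0)).
  rewrite -mulrA xm [LHS]mulrA x0_cx -mulrA [x0 * (x * x0)]mulrA xm !mulrA -cxM rE cx_real.
  by rewrite -!mulrA mulr_algl.
suff r1 : r = 1 by rewrite ax r1 scale1r.
have axn (a : D) : a * x = r *: (x * a) -> forall n, a ^+ n * x = r ^+ n *: (x * a ^+ n).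
  move=> E; elim=> [|n IH]; first by rewrite !expr0 scale1r mul1r mulr1.
  by rewrite exprSr -mulrA E -scalerAr mulrA IH -scalerAl scalerA -exprS -mulrA.
have [n [s [s0 sE]]] := x0_sq_pow; apply: (@nonneg_root1 _ n r0).
have := axn _ ax n.+1; rewrite sE mulr_algl mulr_algr scalerA => /eqP.
rewrite -subr_eq0 -scalerBl scaler_eq0 (negPf xn0) orbF subr_eq0.
by rewrite -{1}[s]mul1r (inj_eq (mulIf s0)) => /eqP.
Qed.

(** By [x0_sq_central], conjugation by [x0] is an involution on [D_t], so [x] plus its conjugate
    commutes with [x0]. If this sum is 0, then [x] anticommutes with [x0], as [i] does, and [i * x]
    commutes with it. *)
Lemma exists_commuting_x0 (t : T) :
  exists y, [/\ y \in Gm (val t), y != 0 & x0 * y = y * x0].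
Proof.
have xn0 : vpick (Gm (val t)) != 0 by rewrite vpick0; exact: (valP t).
have xt := memv_pick (Gm (val t)); move: (vpick _) xn0 xt => x xn0 xt.
pose c := x0 * x * x0^-1.
have cG : c \in Gm (val t).
  have := homogM (homogM x0G xt) (homogV dim2 x0G x0_neq0).
  by rewrite (mulgC (val t0)) -mulgA -[(val t0 * _)%g]/(val (t0 * t0^-1)%g) mulgV mulg1.
have cE : c * x0 = x0 * x by rewrite mulrVK.
have c2 : x0 * c = x * x0.
  by apply: (mulIr x0U); rewrite -mulrA cE mulrA (x0_sq_central xt) mulrA.
clearbody c.
have [E|E] := eqVneq (x + c) 0; last first.
  exists (x + c); split=> //; first exact: memvD.
  by rewrite mulrDr mulrDl cE c2 addrC.
have cN : c = - x by apply/eqP; rewrite -addr_eq0 addrC E.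
exists (i * x); split.
- by rewrite -[val t]mul1g homogM.
- by apply: contra_neq xn0 => ix; apply/eqP; rewrite -oppr_eq0 -mulN1r -ii -mulrA ix mulr0.
have := kappa_i dim2 iD ii x0G; rewrite /kappa_fun (negPf t0K) /= => xi.
rewrite mulrA xi; move: cE; rewrite cN mulNr => xx.
by rewrite scaleN1r mulNr -!mulrA -xx mulrN opprK.
Qed.

Variable y : T -> D.
Hypotheses (yG : forall t, y t \in Gm (val t)) (y0 : forall t, y t != 0).
Hypothesis yx : forall t, x0 * y t = y t * x0.

Let yU t : y t \is a GRing.unit. Proof. exact: hcomp_unit (yG t) (y0 t). Qed.

(** [x] is [cx z * y t], and commuting with [x0] makes [z] equal to its conjugate. *)
Lemma commuting_x0_line (t : T) x : x \in Gm (val t) -> x0 * x = x * x0 ->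
  exists r : R, x = r *: y t.
Proof.
move=> xt; have [_ /cx_onto[z ->] ->] := homog_div dim2 (yG t) (y0 t) xt.
rewrite mulrA x0_cx -mulrA yx mulrA => /(mulIr x0U)/(mulIr (yU t))/cx_inj/eqP.
rewrite conjc_fixed; case: z => a b /= /eqP ->.
by exists a; rewrite cx_real mulr_algl.
Qed.

Let yM s t : exists r : R, y s * y t = r *: y (s * t)%g.
Proof.
apply: commuting_x0_line; first exact: homogM.
by rewrite mulrA yx -mulrA yx mulrA.
Qed.

Lemma split_t0 (t : T) : val t \notin K -> val (t * t0^-1)%g \in K.
Proof.
move=> tK; apply: contraNT tK => tK'; have := kappaM dim2 iD ii (t * t0^-1)%g t0.
by rewrite mulgVK /kappa_fun tK' t0K; case: (_ \in K).
Qed.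

(** [D_t] is [D_e (y t)] for [t] in [K] and [D_e (y (t / t0)) x0] otherwise. *)
Lemma stab_eq_x0 (f h : Stab) : f i = h i -> f x0 = h x0 ->
  (forall t : T, val t \in K -> f (y t) = h (y t)) -> f = h.
Proof.
move=> fi fx fy; have fcx z : f (cx z) = h (cx z).
  by rewrite /cx_emb !linearD !linearZ /= !rmorph1 fi.
apply: stab_eq => t x xt; have [tK|tK] := boolP (val t \in K).
  have [_ /cx_onto[z ->] ->] := homog_div dim2 (yG t) (y0 t) xt.
  by rewrite !stab_rmorphM fcx fy.
have uG : y (t * t0^-1)%g * x0 \in Gm (val t) by rewrite -[t in val t](mulgVK t0); apply: homogM.
have u0 : y (t * t0^-1)%g * x0 != 0.
  by apply: contraTneq x0U => E; rewrite -(unitrMr _ (yU (t * t0^-1)%g)) E unitr0.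
have [_ /cx_onto[z ->] ->] := homog_div dim2 uG u0 xt.
by rewrite !stab_rmorphM fcx fx fy ?split_t0.
Qed.

Lemma stab_i (f : Stab) : exists e : pm1, f i = pmr R e *: i.
Proof.
have /cx_onto[z zE] := stab_homog f iD.
have : cx z * cx z = - 1 by rewrite -zE -stab_rmorphM ii linearN /= rmorph1.
rewrite -cxM -(cx1 i) -cxN => /cx_inj; rewrite zE; case: z {zE} => a b [re im].
have ab : a * b = 0 by lra.
have a0 : a = 0.
  move/eqP: ab; rewrite mulf_eq0 => /orP[/eqP //|/eqP b0].
  by move: re; rewrite b0 mulr0 subr0; have := sqr_ge0 a; rewrite expr2; lra.
have : b * b = 1 by move: re; rewrite a0; lra.
move/eqP; rewrite -expr2 sqrf_eq1 a0 /cx_emb /= scale0r add0r => /orP[]/eqP->.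
  by exists 1%g.
by exists (pmb true).
Qed.

Lemma stab_cx (f : Stab) e z : f i = pmr R e *: i ->
  f (cx z) = cx (if e == 1%g then z else conjc z).
Proof.
move=> fi; rewrite /cx_emb linearD !linearZ /= rmorph1 fi.
case: eqP => [->|/pm1_neq1->]; first by rewrite scale1r.
by case: z => a b /=; rewrite scaleN1r scaleNr scalerN.
Qed.

(** An element of [D_e] commutes with [i] and with [y t] for [t] in [K], and moving it past [x0]
    conjugates it. *)
Lemma inner_phase (z : units R[i]) : exists2 f : Stab,
  forall x, f x = cx (val z) * x * (cx (val z))^-1 &
  [/\ f i = i, f x0 = cx (phase z) * x0 & forall t : T, val t \in K -> f (y t) = y t].
Proof.
have zU := cx_unit dim2 iD ii z.
have z0 : cx (val z) != 0 by apply: contraTneq zU => ->; rewrite unitr0.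
have [f fE] := stab_inner dim2 (t := 1%g) (cx_mem (val z)) z0; exists f => //; split.
- have : cx (val z) * cx 'i%C = cx 'i%C * cx (val z) by rewrite -!cxM mulrC.
  by rewrite cxi fE => ->; rewrite mulrK.
- rewrite fE; apply: (mulIr zU); rewrite mulrVK // -mulrA x0_cx mulrA -cxM.
  by rewrite /phase divfK // conjc_neq0.
- by move=> t tK; rewrite fE -(cent_suppP dim2 iD ii tK (yG t)) mulrK.
Qed.

(** If [f x0 = u x0], then [f] multiplies [x0 * x0] by [|u|^2]. Since [f] fixes some power of
    [x0 * x0], a nonzero real, [|u|] is 1 and [phase_onto] applies. *)
Lemma stab_phase (f : Stab) : exists z : units R[i], f x0 = cx (phase z) * x0.
Proof.
have [_ /cx_onto[u ->] fx] := homog_div dim2 x0G x0_neq0 (stab_homog f x0G).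
suff /phase_onto[z zE] : u * conjc u = 1 by exists z; rewrite zE.
have [r r0 rE] := normc_real u.
have fa : f (x0 * x0) = r *: (x0 * x0).
  rewrite stab_rmorphM fx mulrA -[cx u * x0 * cx u]mulrA x0_cx mulrA -cxM.
  by rewrite [u * _]mulrC rE cx_real -mulrA mulr_algl.
have [n [s [s0 sE]]] := x0_sq_pow.
suff r1 : r = 1 by rewrite mulrC rE r1.
apply: (@nonneg_root1 _ n r0); have : f ((x0 * x0) ^+ n.+1) = (x0 * x0) ^+ n.+1.
  by rewrite sE linearZ /= rmorph1.
rewrite rmorphXn /= fa exprZn sE scalerA => /eqP.
rewrite -subr_eq0 -scalerBl scaler_eq0 oner_eq0 orbF subr_eq0.
by rewrite -{2}[s]mul1r (inj_eq (mulIf s0)) => /eqP.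
Qed.

(** The character of [f]: its eigenvalues on the [y t] for [t] in [K], and at [t0] the sign of its
    action on [i]. As [K] and [t0] generate [T], it is unique. *)
Definition stab_char_rel (f : Stab) (k : homg T pm1) : Prop :=
  (forall t : T, val t \in K -> f (y t) = pmr R (k t) *: y t) /\ f i = pmr R (k t0) *: i.

Lemma pmr_scale_inj (e e' : pm1) (x : D) : x != 0 -> pmr R e *: x = pmr R e' *: x -> e = e'.
Proof.
move=> xn0 /eqP; rewrite -subr_eq0 -scalerBl scaler_eq0 (negPf xn0) orbF subr_eq0.
by move/eqP/(@pmr_inj R).
Qed.

Let i_neq0 : i != 0.
Proof. by apply: contra_eq_neq ii => ->; rewrite mul0r eq_sym oppr_eq0 oner_eq0. Qed.

Lemma stab_char_uniq f k k' : stab_char_rel f k -> stab_char_rel f k' -> k = k'.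
Proof.
move=> [fk ik] [fk' ik']; apply: homg_eq.
have kK t : val t \in K -> k t = k' t.
  by move=> tK; apply: (pmr_scale_inj (y0 t)); rewrite -fk ?fk'.
have k0 : k t0 = k' t0 by apply: (pmr_scale_inj i_neq0); rewrite -ik.
move=> t; have [/kK//|/split_t0/kK E] := boolP (val t \in K).
by rewrite -[t](mulgVK t0 t) !(homgM _ (t / t0)%g t0) E k0.
Qed.

Lemma stab_charM f k f' k' : stab_char_rel f k -> stab_char_rel f' k' ->
  stab_char_rel (f * f')%g (k * k')%g.
Proof.
move=> [fk ik] [fk' ik']; split=> [t tK|]; rewrite stabM.
  by rewrite fk' // linearZ /= fk // scalerA pmrM mulrC.
by rewrite ik' linearZ /= ik scalerA pmrM mulrC.
Qed.

(** Divided by the inner automorphism of the same phase, [f] fixes [x0], so it acts on the [y t] by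
    a character [k]. If [f] negates [i], then [k] is corrected by [kappa], which is trivial on
    [K]. *)
Lemma stab_char_exists f : exists k, stab_char_rel f k.
Proof.
have [z fz] := stab_phase f; have [g _ [gi gx gy]] := inner_phase z.
pose f' := (g^-1 * f)%g; have fE x : f x = g (f' x) by rewrite -stabM mulVKg.
have fx : f' x0 = x0 by apply: (@stab_inj _ _ _ _ g); rewrite -fE gx.
have [|k kE] := eigen_char (y := y) yG y0 yM (f := f').
  move=> t; apply: commuting_x0_line; first exact: stab_homog.
  by rewrite -{1 2}fx -!stab_rmorphM yx.
(* [x0] commutes with itself, so it is a real multiple of [y t0]. *)
have k0 : k t0 = 1%g.
  have [r rE] := commuting_x0_line x0G erefl.
  apply: (@pmr_scale_inj _ _ x0) => //; rewrite scale1r -[RHS]fx [in RHS]rE linearZ /= kE.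
  by rewrite scalerA mulrC -scalerA -rE.
have [e eE] := stab_i f.
have kK t : val t \in K -> f (y t) = pmr R (k t) *: y t.
  by move=> tK; rewrite fE kE linearZ /= gy.
have [e1|/eqP/pm1_neq1 e1] := eqVneq e 1%g.
  by exists k; split=> //; rewrite k0 eE e1.
exists (k * kappa)%g; split=> [t tK|].
  by rewrite kK //= /kappa_fun tK mulg1.
by rewrite eE e1 /= k0 mul1g /kappa_fun t0K.
Qed.

Lemma stab_data : exists2 P : Stab -> homg T pm1, forall f, stab_char_rel f (P f) &
  {morph P : f g / (f * g)%g}.
Proof.
have [P PE] := choice stab_char_exists; exists P => // f g.
exact: stab_char_uniq (PE _) (stab_charM (PE f) (PE g)).
Qed.

Let rel_i (f : Stab) : stab_char_rel f 1%g -> f i = i.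
Proof. by case=> _ ->; rewrite scale1r. Qed.
Let rel_y (f : Stab) : stab_char_rel f 1%g ->
  forall t : T, val t \in K -> f (y t) = y t.
Proof. by case=> H _ t /H ->; rewrite scale1r. Qed.

Let Psi_inner (P : Stab -> homg T pm1) t (f : Stab) :
  (forall f, stab_char_rel f (P f)) ->
  (forall x, f x = y t * x * (y t)^-1) -> P f = 1%g -> forall x, y t * x = x * y t.
Proof.
move=> PE fE f1 x; suff f_id : f = 1%g.
  have := fE x; rewrite f_id id_lfunE => {2}->.
  by rewrite mulrVK.
have := PE f; rewrite f1 => fP; apply: stab_eq_x0.
- by rewrite (rel_i fP) id_lfunE.
- by rewrite fE -yx mulrK // id_lfunE.
- by move=> s sK; rewrite (rel_y fP) // id_lfunE.
Qed.

Lemma complex_elementary : (\dim 'Z({:D}) <= 1)%N -> forall t : T, (t * t = 1)%g.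
Proof.
have [P PE PM] := stab_data.
by apply: (supp_elementary dim2 yG y0 yM PM) => t f; apply: Psi_inner.
Qed.

Lemma complex_all_inner : (\dim 'Z({:D}) <= 2)%N ->
  ~ (forall t : T, (t * t = 1)%g) -> forall f : Stab, inner_aut (val f).
Proof.
have [P PE PM] := stab_data.
apply: (all_inner_of_center dim2 yG y0 yM PM) => [t f|f f1]; first exact: Psi_inner.
have := PE f; rewrite f1 => fP; have [z fz] := stab_phase f.
have [g gE [gi gx gy]] := inner_phase z.
have -> : f = g.
  apply: stab_eq_x0; rewrite ?gx ?gi ?(rel_i fP) // => t tK.
  by rewrite gy ?(rel_y fP).
by exists (cx (val z)) => //; exact: (cx_unit dim2 iD ii z).
Qed.

(** If [k t0] is 1, the automorphism of [k] fixes [i] and [x0], and an inner one adds the phase.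
    Otherwise [k * kappa] takes the place of [k], and conjugation by [x0] negates [i], fixing [x0]
    and all [y t]. *)
Lemma stab_surj (z : units R[i]) (k : homg T pm1) :
  exists2 f : Stab, f x0 = cx (phase z) * x0 & stab_char_rel f k.
Proof.
have [g _ [gi gx gy]] := inner_phase z.
have [k0|/eqP/pm1_neq1 k0] := eqVneq (k t0) 1%g.
  have [h hE] := stab_of_char k; exists (g * h)%g; first by rewrite stabM (hE t0) // k0 scale1r gx.
  split=> [t tK|]; rewrite stabM; first by rewrite (hE t) // linearZ /= gy.
  by rewrite (hE 1%g) // (morph_mul1 (homgM k)) scale1r k0 gi scale1r.
have [h hE] := stab_of_char (k * kappa)%g; have [c cE] := stab_inner dim2 x0G x0_neq0.
have kt0 : (k * kappa)%g t0 = 1%g by rewrite homgME (kappaN1 dim2 iD ii t0K) k0 pm1_sq.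
exists (g * (c * h))%g; first by rewrite !stabM (hE t0) // kt0 scale1r cE mulrK.
split=> [t tK|]; rewrite !stabM.
  rewrite (hE t) // homgME (kappa1 dim2 iD ii tK) mulg1 !linearZ /= cE.
  by rewrite yx mulrK // gy.
rewrite (hE 1%g) // (morph_mul1 (homgM _)) scale1r cE k0.
have := kappa_i dim2 iD ii x0G; rewrite /kappa_fun (negPf t0K) => xi.
by rewrite xi -scalerAl mulrK // linearZ /= gi.
Qed.

Variables (W : abelGroupType) (p : T -> W).
Hypotheses (pM : {morph p : s t / (s * t)%g}) (p_onto : forall w, exists t, p t = w).
Hypothesis p_ker : forall t, p t = 1%g <-> exists s, t = (s * s)%g.

(** [f] goes to the class of its phase and the [w] with [th w] its character. [w] acts by inversion
    when [th w t0] is -1, and [quotient_dual] makes this happen exactly outside [K]. [W] is left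
    general to cover both [T] and its quotient by squares. *)
Lemma complex_stab_iso : exists act : gaction W (CxRx R),
  (forall (t : T) (z : units R[i]), act (p t) (CxRx_class z) =
     if val t \in K then CxRx_class z else CxRx_class (conj_units z)) /\
  group_iso Stab (sdprod act).
Proof.
have [l [_ lP _]] := supp_enum Gm.
have [th [thM thI thS thk]] := quotient_dual lP pM p_onto p_ker kappa t0.
have kt0 : kappa t0 <> 1%g by rewrite /= /kappa_fun t0K.
have [P PE PM] := stab_data; have [Z ZE] := choice stab_phase; have [u uK] := choice thS.
pose a (w : W) (x : CxRx R) : CxRx R := if th w t0 == 1%g then x else x^-1%g.
have pm1_cases (e : pm1) : e = 1%g \/ e = pmb true.
  by have [->|/eqP/pm1_neq1->] := eqVneq e 1%g; [left|right].
have a1 x : a 1%g x = x by rewrite /a (morph_mul1 thM) eqxx.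
have aM w v x : a (w * v)%g x = a w (a v x).
  rewrite /a thM homgME; case: (pm1_cases (th w t0)) => ->; rewrite ?mul1g ?eqxx //.
  by case: (pm1_cases (th v t0)) => ->; rewrite ?mulg1 ?pm1_sq ?eqxx ?invgK.
have a_mul w : {morph a w : x y / (x * y)%g}.
  by move=> x x'; rewrite /a; case: ifP => _; [reflexivity | rewrite invgM; exact: mulgC].
pose act := Gaction a1 aM a_mul; exists act; split=> [t z|].
  rewrite -[gact _ _]/(a (p t)) /a (thk kt0) -CxRx_conj.
  case: (boolP (val t \in K)) => tK.
    by rewrite (kappa1 dim2 iD ii tK) eqxx.
  by rewrite (kappaN1 dim2 iD ii tK).
have FM : {morph (fun f : Stab => (CxRx_class (Z f), u (P f)) : sdprod act) : f g / (f * g)%g}.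
  move=> f g; congr pair; last by apply: thI; rewrite thM !uK PM.
  have [_ fi] := PE f.
  (* Apply [f] to [g x0 = cx (phase (Z g)) * x0]; on [D_e], [f] is conjugation exactly when [P f t0]
     is -1. *)
  have : phase (Z (f * g)%g) =
      (if P f t0 == 1%g then phase (Z g) else conjc (phase (Z g))) * phase (Z f).
    apply: cx_inj; apply: (mulIr x0U); rewrite -ZE stabM ZE stab_rmorphM.
    by rewrite (stab_cx _ fi) ZE mulrA cxM.
  rewrite /= /a uK; case: ifP => _ phE.
    by rewrite -CxRx_classM; apply/phase_classP; rewrite phE phaseM mulrC.
  by rewrite -CxRx_classV -CxRx_classM; apply/phase_classP; rewrite phE phaseM phaseV mulrC.
apply: (group_isoP FM).
- apply: (morph_inj FM) => f [Zf Pf].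
  have Zf1 : phase (Z f) = 1 by rewrite -(phase1 R); apply/phase_classP; rewrite Zf.
  have Pf1 : P f = 1%g by rewrite -(uK (P f)) Pf (morph_mul1 thM).
  have := PE f; rewrite Pf1 => fP; apply: stab_eq_x0.
  + by rewrite (rel_i fP) id_lfunE.
  + by rewrite ZE Zf1 cx1 mul1r id_lfunE.
  + by move=> t tK; rewrite (rel_y fP) // id_lfunE.
case=> x w; have [z zE] := CxRx_class_onto x; have [f fx fk] := stab_surj z (th w).
exists f; congr pair.
  rewrite -zE; apply/phase_classP/cx_inj/(mulIr x0U); by rewrite -ZE.
by apply: thI; rewrite uK; apply: stab_char_uniq fk.
Qed.

End Anticommuting.

(** * The stabilizer *)

Section Assembly.
Variables (R : realType) (G : abelGroupType) (D : falgType R).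
Variable Gm : divGrading G D.
Local Notation T := (suppg Gm).
Local Notation Stab := (stabg Gm).

Lemma elementary2P : elementary2 (supp Gm) <-> forall t : T, (t * t = 1)%g.
Proof.
split=> [el t|el g gs]; first by apply/val_inj; exact: el (valP t).
exact: (congr1 val (el (Suppg gs))).
Qed.

Lemma elementary_ker (t : T) : (forall s : T, (s * s = 1)%g) ->
  t = 1%g <-> exists s, t = (s * s)%g.
Proof. by move=> el; split=> [->|[s ->]//]; exists 1%g; rewrite mulg1. Qed.

Lemma homg_iso_self : (forall t : T, (t * t = 1)%g) -> group_iso (homg T pm1) T.
Proof.
have [l [_ lP _]] := supp_enum Gm => el.
apply: (homg_iso_quotient (p := id) lP) => // [t|t]; first by exists t.
exact: elementary_ker.
Qed.

Lemma homg_iso_squares : group_iso (homg T pm1) (quotg (squares T)).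
Proof.
have [l [_ lP _]] := supp_enum Gm.
exact: (homg_iso_quotient lP (@cosetgM T) (@cosetg_onto T) (@cosetg_ker T)).
Qed.

Lemma two_dimensional : digit2 Gm -> (\dim 'Z({:D}) <= 2)%N ->
  [/\ (\dim 'Z({:D}) <= 1)%N -> forall t : T, (t * t = 1)%g,
      ~ (forall t : T, (t * t = 1)%g) -> forall f : Stab, inner_aut (val f)
    & forall (W : abelGroupType) (p : T -> W), {morph p : s t / (s * t)%g} ->
        (forall w, exists t, p t = w) ->
        (forall t, p t = 1%g <-> exists s, t = (s * s)%g) ->
      exists act : gaction W (CxRx R),
        (forall (t : T) (z : units R[i]), act (p t) (CxRx_class z) =
           if val t \in cent_supp Gm then CxRx_class z else CxRx_class (conj_units z)) /\
        group_iso Stab (sdprod act)].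
Proof.
move=> [dim2 nZ] Z2; have [i iD ii] := identity_imaginary_unit dim2.
have [t0 t0K] := exists_notin_K dim2 iD ii Z2 nZ.
have x0n : vpick (Gm (val t0)) != 0 by rewrite vpick0; exact: (valP t0).
have x0G := memv_pick (Gm (val t0)).
have /choice[y yP] := exists_commuting_x0 dim2 iD ii t0K x0G x0n.
have [yG y0 yx] : [/\ forall t, y t \in Gm (val t), forall t, y t != 0 &
    forall t, vpick (Gm (val t0)) * y t = y t * vpick (Gm (val t0))].
  by split=> t; have [] := yP t.
split.
- exact: (complex_elementary dim2 iD ii t0K x0G x0n yG y0 yx).
- exact: (complex_all_inner dim2 iD ii t0K x0G x0n yG y0 yx Z2).
- exact: (complex_stab_iso dim2 iD ii t0K x0G x0n yG y0 yx).
Qed.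

Lemma four_dimensional : digit3 Gm ->
  [/\ (\dim 'Z({:D}) <= 1)%N -> forall t : T, (t * t = 1)%g,
      (\dim 'Z({:D}) <= 2)%N -> ~ (forall t : T, (t * t = 1)%g) ->
        forall f : Stab, inner_aut (val f)
    & group_iso Stab (algAut (quat R) * homg T pm1)%type].
Proof.
move=> dim4; have [[i j] /= [iD jD ij]] := identity_quat_pair dim4.
have /choice[y yP] (t : T) : exists u, [/\ u \in Gm (val t), u != 0 &
    {in Gm 1%g, forall x, x * u = u * x}].
  by have [u [uG u0] uC] := exists_commuting dim4 iD jD ij t; exists u.
have [yG y0 yC] : [/\ forall t, y t \in Gm (val t), forall t, y t != 0 &
    forall t, {in Gm 1%g, forall x, x * y t = y t * x}].
  by split=> t; have [] := yP t.
split.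
- exact: (quat_elementary dim4 iD jD ij yG y0 yC).
- exact: (quat_all_inner dim4 iD jD ij yG y0 yC).
- exact: (quat_stab_iso dim4 iD jD ij yG y0 yC).
Qed.

End Assembly.

Theorem proposition21 (R : realType) (G : abelGroupType) (D : falgType R)
    (Gm : divGrading G D)
    (D_simple : simple_algebra D)
    (not_complex :
       ~ (Gm 1%g = 'Z({:D})%VS /\ subalgebra_iso (Rcomplex R) (Gm 1%g))) :
  let T : abelGroupType := suppg Gm in
  let T_T2 : abelGroupType := quotg (squares T) in
  let K := cent_supp Gm in
  let Stab : groupType := stabg Gm in
  let HomT : abelGroupType := homg T pm1 in
  let AutH : groupType := algAut (quat R) in
  let all_inner := forall f : Stab, inner_aut (val f) in
  [/\ (* i *)
      type_1a Gm \/ type_1b Gm \/ type_1c Gm ->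
        group_iso Stab HomT /\ group_iso HomT T,
      (* ii *)
      type_1d Gm ->
        [/\ all_inner, group_iso Stab HomT & group_iso HomT T_T2],
      (* iii *)
      type_2a Gm \/ type_2b Gm \/ type_2c Gm ->
        exists act : gaction T (CxRx R),
          (forall (t : T) (z : units R[i]),
             act t (CxRx_class z) =
               if val t \in K then CxRx_class z else CxRx_class (conj_units z)) /\
          group_iso Stab (sdprod act),
      (* iv *)
      type_2d Gm \/ type_2e Gm ->
        all_inner /\
        exists act : gaction T_T2 (CxRx R),
          (forall (t : T) (z : units R[i]),
             act (cosetg (squares T) t) (CxRx_class z) =
               if val t \in K then CxRx_class z else CxRx_class (conj_units z)) /\
          group_iso Stab (sdprod act)
    & (* v, vi *)
      (type_3a Gm \/ type_3b Gm \/ type_3c Gm ->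
         group_iso Stab (AutH * HomT)%type /\
         group_iso (AutH * HomT)%type (AutH * T)%type) /\
      (type_3d Gm ->
         [/\ all_inner, group_iso Stab (AutH * HomT)%type
           & group_iso (AutH * HomT)%type (AutH * T_T2)%type])].
Proof.
move=> T T_T2 K Stab HomT AutH all_inner.
have nel : ~ elementary2 (supp Gm) -> ~ (forall t : T, (t * t = 1)%g).
  by move=> n el; apply/n/elementary2P.
(* In (iii) the support is elementary, by the dimension of the center or by assumption, so [T] with
   the identity map serves as its own quotient by squares. *)
have two dimZ : digit2 Gm -> (\dim 'Z({:D}) <= dimZ)%N -> (dimZ <= 2)%N ->
    (dimZ <= 1)%N \/ (forall t : T, (t * t = 1)%g) ->
    exists act : gaction T (CxRx R),
      (forall (t : T) (z : units R[i]), act t (CxRx_class z) =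
         if val t \in K then CxRx_class z else CxRx_class (conj_units z)) /\
      group_iso Stab (sdprod act).
  move=> d2 Z d2' el; have [el1 _ iso] := two_dimensional d2 (leq_trans Z d2').
  apply: (iso T id) => // [t|t]; first by exists t.
  by apply: elementary_ker; case: el => // d1; apply/el1/(leq_trans Z).
split.
- move=> H; have d1 : digit1 Gm by case: H => [[]|[[]|[]]].
  split; first exact: line_stab_iso d1.
  apply: homg_iso_self; case: H => [[_ /center_MnR]|[[_ /center_MnH]|[_ _ /elementary2P//]]];
    exact: line_elementary d1.
- case=> d1 /center_MnC Z2 /nel ne; split; last exact: homg_iso_squares.
    exact: (line_all_inner d1 Z2 ne).
  exact: line_stab_iso d1.
- case=> [[d2 /center_MnR Z]|[[d2 /center_MnH Z]|[d2 /center_MnC Z /elementary2P el]]].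
  + by apply: two Z _ _ => //; left.
  + by apply: two Z _ _ => //; left.
  + by apply: two Z _ _ => //; right.
- move=> H; have [d2 Z ne] : [/\ digit2 Gm, (\dim 'Z({:D}) <= 2)%N &
      ~ (forall t : T, (t * t = 1)%g)].
    by case: H => [[d2 /center_MnC Z /nel ne _]|[d2 /center_MnC Z /nel ne _]].
  have [_ inn iso] := two_dimensional d2 Z; split; first exact: inn.
  exact: (iso _ _ (@cosetgM T) (@cosetg_onto T) (@cosetg_ker T)).
split.
- move=> H; have d3 : digit3 Gm by case: H => [[]|[[]|[]]].
  have [el _ iso] := four_dimensional d3; split=> //.
  apply/group_iso_prod/homg_iso_self.
  by case: H => [[_ /center_MnR/el]|[[_ /center_MnH/el]|[_ _ /elementary2P]]].
- case=> d3 /center_MnC Z2 /nel ne; have [_ inn iso] := four_dimensional d3.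
  split=> //; first exact: inn.
  exact/group_iso_prod/homg_iso_squares.
Qed.
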